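(* Let $\mathsf V$ be a pseudovariety of semigroups containing $\mathcal{L}\mathsf{Sl}$ and such that $\mathsf V=\mathsf V\ast\mathsf D$. Then the assignment $\mathcal X\mapsto \mathbb K(\mathcal M_{\mathsf V}(\mathcal X))$ on subshifts and $\varphi\mapsto\varphi_{\mathbb K_{\mathsf V}}$ on morphisms of subshifts (where $\varphi\colon\mathcal X\to\mathcal Y$ is sent to $\varphi_{\mathbb K_{\mathsf V}}\colon \mathbb K(\mathcal M_{\mathsf V}(\mathcal X))\to\mathbb K(\mathcal M_{\mathsf V}(\mathcal Y))$) is a functor from the category of subshifts to the category of compact categories.
   Context: Alphabets are finite nonempty sets; $A^+$ (resp. $A^*$) is the free semigroup (resp. monoid) on $A$, and $\varepsilon$ is the empty word. Compact spaces are Hausdorff. For a semigroup $S$, $S^I=S\uplus\{I\}$ is $S$ with an (isolated) identity $I$ adjoined. Pseudovarieties. A pseudovariety of semigroups is a class of finite semigroups closed under subsemigroups, homomorphic images and finite direct products. $\mathcal L\mathsf{Sl}$ is the class of finite semigroups $S$ such that $eSe$ is a semilattice (commutative, all elements idempotent) for every idempotent $e$ of $S$. $\mathsf D$ is the class of finite semigroups $S$ with $Se=\{e\}$ for every idempotent $e$ of $S$. $\mathsf V\ast\mathsf W$ is the least pseudovariety containing all semidirect products (for left actions) of an element of $\mathsf V$ with an element of $\mathsf W$. Pseudowords. $\widehat F_{\mathsf V}(A)$ is the free pro-$\mathsf V$ semigroup on $A$, i.e. the inverse limit of the finite quotients of $A^+$ belonging to $\mathsf V$. If $\mathsf V\supseteq\mathcal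 L\mathsf{Sl}$, $A^+$ embeds in it as a dense subsemigroup of isolated points; elements of $\widehat F_{\mathsf V}(A)$ are called pseudowords, and those not in $A^+$ infinite. For an infinite pseudoword $u$, $\mathsf i_k(u)$ and $\mathsf t_k(u)$ are its unique prefix and suffix in $A^*$ of length $k$. Subshifts. A subshift of $A^{\mathbb Z}$ is a nonempty closed set $\mathcal X\subseteq A^{\mathbb Z}$ with $\sigma_A(\mathcal X)=\mathcal X$, where $\sigma_A((x_i)_i)=(x_{i+1})_i$. $L(\mathcal X)\subseteq A^+$ is the set of nonempty finite words occurring in elements of $\mathcal X$. A morphism $\varphi\colon\mathcal X\to\mathcal Y$ between subshifts is a continuous map commuting with the shift maps. Each morphism $\varphi\colon\mathcal X\to\mathcal Y$, with $\mathcal X\subseteq A^{\mathbb Z}$, $\mathcal Y\subseteq B^{\mathbb Z}$, has a central block map: a map $\Phi\colon A^{2k+1}\to B$ (for some $k\ge 0$, called the wing) with $\varphi(x)=(\Phi(x_{i-k}\cdots x_{i+k}))_{i\in\mathbb Z}$ for all $x\in\mathcal X$. Mirage. $\mathcal M_{\mathsf V}(\mathcal X)$ is the set of $u\in\widehat F_{\mathsf V}(A)$ all of whose factors in $A^+$ belong to $L(\mathcal X)$. Compact categories. A compact category is a small category whose sets of objects and of arrows are compact spaces such that domain, codomain, $x\mapsto 1_x$, and composition are continuous. Morphisms of compact categories are functors continuous on objects and on arrows. For a compact semigroup $S$, the Karoubi envelope $\mathbb K(S)$ has as objects the idempotents of $S$, and as arrows $f\to e$ the triples $(e,s,f)$ with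 $s\in S$, $s=esf$; composition is $(e,s,f)(f,t,g)=(e,st,g)$ and topologies are induced from $S$ and $S\times S\times S$. $\mathbb K(\mathcal M_{\mathsf V}(\mathcal X))$ is the compact subcategory of $\mathbb K(\widehat F_{\mathsf V}(A))$ whose objects are the idempotents in $\mathcal M_{\mathsf V}(\mathcal X)$ and whose arrows are the $(e,u,f)$ with $u\in\mathcal M_{\mathsf V}(\mathcal X)$. The functor $\varphi_{\mathbb K_{\mathsf V}}$. Given $\Phi\colon A^{N}\to B$ with $N=2k+1$, let $\overline\Phi\colon A^*\to B^*$ send words of length $<N$ to $\varepsilon$, and $a_1\cdots a_M$ ($M\ge N$) to $\Phi(a_1\cdots a_N)\Phi(a_2\cdots a_{N+1})\cdots\Phi(a_{M-N+1}\cdots a_M)$. When $\mathsf V=\mathsf V\ast\mathsf D\supseteq\mathcal L\mathsf{Sl}$, $\overline\Phi$ has a unique continuous extension $\overline\Phi\colon\widehat F_{\mathsf V}(A)^I\to\widehat F_{\mathsf V}(B)^I$. For an idempotent $e$ of $\widehat F_{\mathsf V}(A)$ put $\Phi_{\mathbb K_{\mathsf V}}(e)=\overline\Phi(\mathsf t_k(e)\,e\,\mathsf i_k(e))$, and for an arrow put $\Phi_{\mathbb K_{\mathsf V}}(e,u,f)=(\Phi_{\mathbb K_{\mathsf V}}(e),\overline\Phi(\mathsf t_k(e)\,u\,\mathsf i_k(f)),\Phi_{\mathbb K_{\mathsf V}}(f))$; this is a functor $\mathbb K(\widehat F_{\mathsf V}(A))\to\mathbb K(\widehat F_{\mathsf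 V}(B))$. For a morphism $\varphi\colon\mathcal X\to\mathcal Y$ of subshifts, $\varphi_{\mathbb K_{\mathsf V}}\colon\mathbb K(\mathcal M_{\mathsf V}(\mathcal X))\to\mathbb K(\mathcal M_{\mathsf V}(\mathcal Y))$ is the restriction of $\Phi_{\mathbb K_{\mathsf V}}$, for any central block map $\Phi$ of $\varphi$ (it does take values in $\mathbb K(\mathcal M_{\mathsf V}(\mathcal Y))$ and does not depend on the choice of $\Phi$). *)

(* Defs.v *)
From HB Require Import structures.
From mathcomp Require Import all_boot all_order all_algebra.
From mathcomp Require Import all_classical topology.

Set Implicit Arguments.
Unset Strict Implicit.
Unset Printing Implicit Defensive.

Import GRing.Theory.
Local Open Scope classical_set_scope.
Local Open Scope group_scope.

#[short(type="finSemigroupType")]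
HB.structure Definition FinSemigroup := {S of Semigroup S & Finite S}.

HB.instance Definition _ (S T : finSemigroupType) :=
  Finite.on (S * T)%type.

(** The empty semigroup is allowed; by [pv_sub] it belongs to every
    pseudovariety, so this convention does not affect the nonempty members. *)
Record pseudovariety (V : set finSemigroupType) : Prop := Pseudovariety {
  pv_sub : forall (S T : finSemigroupType) (f : {multiplicative S -> T}),
    injective f -> V T -> V S;
  pv_img : forall (S T : finSemigroupType) (f : {multiplicative S -> T}),
    (forall t, exists s, f s = t) -> V S -> V T;
  (* the empty product *)
  pv_one : forall S : finSemigroupType, #|S| = 1%N -> V S;
  pv_prod : forall S T : finSemigroupType, V S -> V T -> V (S * T)%type
}.

Definition idempotent_elt (S : magmaType) (e : S) : Prop := e * e = e.

Definition LSl : set finSemigroupType := [set S : finSemigroupType |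
  forall e : S, idempotent_elt e ->
    (forall x y : S, (e * x * e) * (e * y * e) = (e * y * e) * (e * x * e)) /\
    (forall x : S, idempotent_elt (e * x * e))].

Definition Dpv : set finSemigroupType := [set S : finSemigroupType |
  forall e : S, idempotent_elt e -> forall s : S, s * e = e].

Record left_action (T S : semigroupType) := LeftAction {
  act :> T -> S -> S;
  actA : forall t t' s, act (t * t') s = act t (act t' s);
  actM : forall t s s', act t (s * s') = act t s * act t s'
}.

Definition semidirect (S T : finSemigroupType) (a : left_action T S) : Type :=
  (S * T)%type.

Section Semidirect.
Variables (S T : finSemigroupType) (a : left_action T S).
HB.instance Definition _ := Finite.copy (semidirect a) (S * T)%type.
Definition semidirect_mul (x y : semidirect a) : semidirect a :=
  (x.1 * a x.2 y.1, x.2 * y.2).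
Fact semidirect_mulA : associative semidirect_mul.
Proof.
by move=> [s t] [s' t'] [s'' t'']; rewrite /semidirect_mul/= actM actA !mulgA.
Qed.
HB.instance Definition _ := isSemigroup.Build (semidirect a) semidirect_mulA.
End Semidirect.

Definition pv_star (V W : set finSemigroupType) : set finSemigroupType :=
  [set U : finSemigroupType | forall P : set finSemigroupType, pseudovariety P ->
    (forall (S T : finSemigroupType) (a : left_action T S),
      V S -> W T -> P (semidirect a)) -> P U].

(** [word A] is the free semigroup A^+; [seq A] plays the role of A^*. *)
Record word (A : Type) := Word { wval :> seq A; _ : ~~ nilp wval }.
HB.instance Definition _ (A : Type) := [isSub for @wval A].
HB.instance Definition _ (A : choiceType) := [Choice of word A by <:].

Section FreeSemigroup.
Variable A : choiceType.
Fact word_mul_subproof (u v : word A) : ~~ nilp (u ++ v).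
Proof. by case: u => [[]]. Qed.
Definition word_mul (u v : word A) : word A := Word (word_mul_subproof u v).
Fact word_mulA : associative word_mul.
Proof. by move=> u v w; apply: val_inj; rewrite /= catA. Qed.
HB.instance Definition _ := isSemigroup.Build (word A) word_mulA.
End FreeSemigroup.

HB.mixin Record isCompactSemigroup S of Semigroup S & Topological S := {
  mulg_continuous : continuous (fun p : S * S => p.1 * p.2);
  cs_compact : compact [set: S];
  cs_hausdorff : hausdorff_space S
}.
#[short(type="compactSemigroupType")]
HB.structure Definition CompactSemigroup :=
  {S of Semigroup S & Topological S & isCompactSemigroup S}.

Definition in_set (T : Type) (A : set T) (x : T) (Ax : A x) : A :=
  exist _ x (mem_set Ax).

Section SubspaceFacts.
Variables T : topologicalType.
Implicit Types A : set T.

Lemma val_continuous A : continuous (\val : A -> T).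
Proof. by rewrite -set_valE; exact: initial_continuous. Qed.

Lemma continuous_into A (U : topologicalType) (f : U -> A) :
  continuous (fun u => \val (f u)) -> continuous f.
Proof. by move=> cf; apply: continuous_comp_initial; rewrite set_valE. Qed.

Lemma set_type_hausdorff A : hausdorff_space T -> hausdorff_space A.
Proof.
move=> hT p q cpq; apply: val_inj; apply: hT => B C nB nC.
by have [z [Bz Cz]] := cpq _ _ (val_continuous nB) (val_continuous nC);
  exists (\val z).
Qed.

Lemma set_type_compact A : compact A -> compact [set: A].
Proof.
move=> cA F FF _; have [|p [Ap clp]] := cA (\val @ F) _.
  have : F [set x : A | A (\val x)] by apply: filterS filterT => x _; exact: set_valP.
  by [].
exists (in_set Ap); split=> // B C FB; rewrite nbhsE => -[W [[W' oW' eW] Wp] WC].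
have FB' : F [set x : A | ([set \val y | y in B]) (\val x)].
  by apply: filterS FB => x Bx; exists x.
have W'p : W' p by move: Wp; rewrite -eW set_valE.
have [z [[x Bx <-] Wz]] := clp _ W' FB' (open_nbhs_nbhs (conj oW' W'p)).
by exists x; split=> //; apply: WC; rewrite -eW set_valE.
Qed.

Lemma closed_eqfun (U : topologicalType) (f g : T -> U) : hausdorff_space U ->
  continuous f -> continuous g -> closed [set x | f x = g x].
Proof.
move=> hU cf cg p clp; apply: hU => B C nB nC.
have n : nbhs p (f @^-1` B `&` g @^-1` C).
  by apply: filterI; [exact: cf|exact: cg].
have [x [/= efg [Bx Cx]]] := clp _ n.
by exists (f x); split=> //; rewrite efg.
Qed.

End SubspaceFacts.

Lemma setX_hausdorff (T U : topologicalType) :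
  hausdorff_space T -> hausdorff_space U -> hausdorff_space (T * U)%type.
Proof.
move=> hT hU [p p'] [q q'] cl; congr pair.
  apply: hT => B C nB nC; have [||[z z'] [Bz Cz]] :=
    cl (fst @^-1` B) (fst @^-1` C); [exact: cvg_fst|exact: cvg_fst|].
  by exists z.
apply: hU => B C nB nC; have [||[z z'] [Bz Cz]] :=
  cl (snd @^-1` B) (snd @^-1` C); [exact: cvg_snd|exact: cvg_snd|].
by exists z'.
Qed.

Lemma continuous_pair (T U W : topologicalType) (f : T -> U) (g : T -> W) :
  continuous f -> continuous g -> continuous (fun x => (f x, g x)).
Proof. by move=> cf cg x; apply: cvg_pair; [exact: cf|exact: cg]. Qed.

Section FreeProV.
Variables (V : set finSemigroupType) (A : finType).

Record vquotient := VQuotient {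
  vq_sgp :> finSemigroupType;
  vq_mem : V vq_sgp;
  vq_map : {multiplicative word A -> vq_sgp};
  vq_surj : forall s, exists w, vq_map w = s
}.

Definition vq_prod := prod_topology (fun q : vquotient => discrete_topology q).
HB.instance Definition _ := gen_eqMixin vquotient.

(** The inverse limit is taken over all the morphisms between quotients that
    commute with the projections from A^+. *)
Definition compatible : set vq_prod := [set x : vq_prod |
  forall (q r : vquotient) (h : {multiplicative q -> r}),
    (forall w, h (vq_map q w) = vq_map r w) -> h (x q) = x r].

Definition freeProV : Type := set_type compatible.
HB.instance Definition _ := Topological.copy freeProV (set_type compatible).

Lemma vq_continuous (T : topologicalType) (f : T -> vq_prod) :
  (forall q : vquotient, continuous (fun t => f t q : discrete_topology q)) -> continuous f.
Proof.
move=> cf t; apply/cvg_sup => q U [W [[B oB <-] Bt] WU].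
apply: (filterS WU); apply: (cf q t); exact: open_nbhs_nbhs.
Qed.

Lemma vq_proj_continuous (q : vquotient) :
  continuous (fun x : vq_prod => x q : discrete_topology q).
Proof. exact: (@proj_continuous _ (fun q => discrete_topology (vq_sgp q)) q). Qed.

Definition proV_mul (x y : freeProV) : freeProV.
Proof.
exists (fun q => \val x q * \val y q); apply: mem_set => q r h hqr.
by rewrite gmulfM (set_valP x _ _ _ hqr) (set_valP y _ _ _ hqr).
Defined.

Fact proV_mulA : associative proV_mul.
Proof.
by move=> x y z; apply: val_inj; apply: functional_extensionality_dep => q /=;
  rewrite mulgA.
Qed.

HB.instance Definition _ := isSemigroup.Build freeProV proV_mulA.

Lemma discrete_continuous (X : discreteTopologicalType) (T : topologicalType)
  (f : X -> T) : continuous f.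
Proof.
move=> x U /nbhs_singleton Ux; apply: open_nbhs_nbhs; split=> //.
exact: discrete_open.
Qed.

Fact proV_mul_continuous : continuous (fun p : freeProV * freeProV => p.1 * p.2).
Proof.
apply: continuous_into; apply: vq_continuous => q p.
pose g (x : freeProV) : discrete_topology q := \val x q.
have cg : continuous g.
  move=> x; apply: (@continuous_comp freeProV vq_prod _ _ (fun y => y q)).
    exact: val_continuous.
  exact: vq_proj_continuous.
have n1 (x : freeProV) : nbhs x [set y | g y = g x].
  apply: (cg x [set g x]); apply: open_nbhs_nbhs; split=> //.
  exact: discrete_open.
move=> U /nbhs_singleton Up; exists ([set y | g y = g p.1], [set y | g y = g p.2]).
  by split; exact: n1.
by move=> [x y] [/= ex ey]; rewrite /= -/(g x) -/(g y) ex ey.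
Qed.

Fact compatible_closed : closed compatible.
Proof.
have -> : compatible = \bigcap_(i in [set i : {q : vquotient & {r : vquotient &
    {multiplicative q -> r}}} | forall w, projT2 (projT2 i) (vq_map (projT1 i) w)
      = vq_map (projT1 (projT2 i)) w])
    [set x : vq_prod | projT2 (projT2 i) (x (projT1 i)) = x (projT1 (projT2 i))].
  apply/seteqP; split=> x cx; first by move=> [q [r h]] /= /cx.
  by move=> q r h hqr; exact: (cx (existT _ q (existT _ r h))).
apply: closed_bigI => -[q [r h]] _ /=.
apply: (@closed_eqfun vq_prod (discrete_topology r) (fun x => h (x q))).
- exact: discrete_hausdorff.
- move=> x; apply: (@continuous_comp _ (discrete_topology q)).
    exact: vq_proj_continuous.
  exact: discrete_continuous.
- exact: vq_proj_continuous.
Qed.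

Fact proV_compact : compact [set: freeProV].
Proof.
apply: set_type_compact; apply: (subclosed_compact compatible_closed _ (subsetT _)).
have := @tychonoff vquotient (fun q => discrete_topology (vq_sgp q))
  (fun=> setT) (fun q => @finite_compact (discrete_topology (vq_sgp q)) setT
    (@finite_finset (vq_sgp q) setT)).
by congr compact; apply/seteqP; split.
Qed.

Fact proV_hausdorff : hausdorff_space freeProV.
Proof.
apply: set_type_hausdorff; apply: hausdorff_product => q.
exact: discrete_hausdorff.
Qed.

HB.instance Definition _ := isCompactSemigroup.Build freeProV
  proV_mul_continuous proV_compact proV_hausdorff.
End FreeProV.

(** S^I: [None] is the adjoined isolated identity I. *)
Definition withI (S : Type) : Type := option S.

Section WithI.
Variable S : compactSemigroupType.

HB.instance Definition _ := Choice.copy (withI S) (option S).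

Definition withI_mul (x y : withI S) : withI S :=
  match x, y with
  | Some a, Some b => Some (a * b)
  | None, _ => y
  | _, None => x
  end.
Fact withI_mulA : associative withI_mul.
Proof. by move=> [a|] [b|] [c|] //=; rewrite mulgA. Qed.
Fact withI_mul1 : left_id (None : withI S) withI_mul. Proof. by case. Qed.
Fact withI_1mul : right_id (None : withI S) withI_mul. Proof. by case. Qed.
HB.instance Definition _ :=
  isMonoid.Build (withI S) withI_mulA withI_mul1 withI_1mul.

Definition withI_open (U : set (withI S)) := open [set s : S | U (Some s)].
Fact withI_openT : withI_open setT. Proof. exact: openT. Qed.
Fact withI_openI : setI_closed withI_open.
Proof. by move=> U W oU oW; apply: openI. Qed.
Fact withI_open_bigU (I : Type) (f : I -> set (withI S)) :
  (forall i, withI_open (f i)) -> withI_open (\bigcup_i f i).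
Proof. by move=> of_; apply: bigcup_open => i _; exact: of_. Qed.
HB.instance Definition _ := isOpenTopological.Build (withI S)
  withI_openT withI_openI withI_open_bigU.
End WithI.

Local Obligation Tactic := idtac.

Record compactCategory := CompactCategory {
  Ob : topologicalType;
  Ar : topologicalType;
  dom : Ar -> Ob;
  cod : Ar -> Ob;
  idc : Ob -> Ar;
  composable : set (Ar * Ar) := [set p | dom p.1 = cod p.2];
  comp : forall g f : Ar, dom g = cod f -> Ar;
  dom_id : forall c, dom (idc c) = c;
  cod_id : forall c, cod (idc c) = c;
  dom_comp : forall g f (gf : dom g = cod f), dom (comp gf) = dom f;
  cod_comp : forall g f (gf : dom g = cod f), cod (comp gf) = cod g;
  comp_id_l : forall c f (cf : dom (idc c) = cod f), comp cf = f;
  comp_id_r : forall g c (gc : dom g = cod (idc c)), comp gc = g;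
  compA : forall h g f (hg : dom h = cod g) (gf : dom g = cod f)
    (h_gf : dom h = cod (comp gf)) (hg_f : dom (comp hg) = cod f),
    comp h_gf = comp hg_f;
  Ob_compact : compact [set: Ob];
  Ob_hausdorff : hausdorff_space Ob;
  Ar_compact : compact [set: Ar];
  Ar_hausdorff : hausdorff_space Ar;
  dom_continuous : continuous dom;
  cod_continuous : continuous cod;
  idc_continuous : continuous idc;
  comp_continuous : continuous (fun p : composable => comp (set_valP p))
}.

Record compactFunctor (C D : compactCategory) := CompactFunctor {
  fob : Ob C -> Ob D;
  far : Ar C -> Ar D;
  fob_continuous : continuous fob;
  far_continuous : continuous far;
  far_dom : forall f, dom (far f) = fob (dom f);
  far_cod : forall f, cod (far f) = fob (cod f);
  far_id : forall c, far (idc c) = idc (fob c);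
  far_comp : forall g f (gf : dom g = cod f) (gf' : dom (far g) = cod (far f)),
    far (comp gf) = comp gf'
}.

Lemma compactFunctor_eq (C D : compactCategory) (F G : compactFunctor C D) :
  fob F = fob G -> far F = far G -> F = G.
Proof.
case: F G => [fo fa ? ? ? ? ? ?] [go ga ? ? ? ? ? ?] /= ? ?; subst go ga.
by f_equal; exact: Prop_irrelevance.
Qed.

Record category := Category {
  cobj :> Type;
  chom : cobj -> cobj -> Type;
  cid : forall X, chom X X;
  ccomp : forall X Y Z, chom Y Z -> chom X Y -> chom X Z;
  ccomp_id_l : forall X Y (f : chom X Y), ccomp (cid Y) f = f;
  ccomp_id_r : forall X Y (f : chom X Y), ccomp f (cid X) = f;
  ccompA : forall W X Y Z (h : chom Y Z) (g : chom X Y) (f : chom W X),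
    ccomp h (ccomp g f) = ccomp (ccomp h g) f
}.
Arguments cid {c} X.

Record is_functor (C D : category) (Fo : C -> D)
    (Fm : forall X Y, chom X Y -> chom (Fo X) (Fo Y)) : Prop := IsFunctor {
  functor_id : forall X, Fm X X (cid X) = cid (Fo X);
  functor_comp : forall X Y Z (g : chom Y Z) (f : chom X Y),
    Fm X Z (ccomp g f) = ccomp (Fm Y Z g) (Fm X Y f)
}.

Program Definition cfun_id (C : compactCategory) : compactFunctor C C :=
  @CompactFunctor C C id id _ _ _ _ _ _.
Next Obligation. by move=> C x; exact: cvg_id. Qed.
Next Obligation. by move=> C x; exact: cvg_id. Qed.
Next Obligation. by []. Qed.
Next Obligation. by []. Qed.
Next Obligation. by []. Qed.
Next Obligation. by move=> C g f gf gf'; congr comp; exact: Prop_irrelevance. Qed.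

Program Definition cfun_comp (C D E : compactCategory)
    (G : compactFunctor D E) (F : compactFunctor C D) : compactFunctor C E :=
  @CompactFunctor C E (fob G \o fob F) (far G \o far F) _ _ _ _ _ _.
Next Obligation.
by move=> C D E G F x; apply: continuous_comp; exact: fob_continuous.
Qed.
Next Obligation.
by move=> C D E G F x; apply: continuous_comp; exact: far_continuous.
Qed.
Next Obligation. by move=> C D E G F f /=; rewrite !far_dom. Qed.
Next Obligation. by move=> C D E G F f /=; rewrite !far_cod. Qed.
Next Obligation. by move=> C D E G F f /=; rewrite !far_id. Qed.
Next Obligation.
move=> C D E G F g f gf gf' /=.
have gf1 : dom (far F g) = cod (far F f) by rewrite far_dom far_cod gf.
by rewrite (far_comp gf gf1) (far_comp gf1 gf').
Qed.

Program Definition compactCat : category :=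
  @Category compactCategory compactFunctor cfun_id cfun_comp _ _ _.
Next Obligation. by move=> C D F; exact: compactFunctor_eq. Qed.
Next Obligation. by move=> C D F; exact: compactFunctor_eq. Qed.
Next Obligation. by move=> *; exact: compactFunctor_eq. Qed.

(** [P] is the set of objects and [Q] the set of arrows. *)
Record is_compact_subcategory (C : compactCategory) (P : set (Ob C))
    (Q : set (Ar C)) : Prop := IsCompactSubcategory {
  sub_dom : forall f, Q f -> P (dom f);
  sub_cod : forall f, Q f -> P (cod f);
  sub_id : forall c, P c -> Q (idc c);
  sub_comp : forall g f (gf : dom g = cod f), Q g -> Q f -> Q (comp gf);
  sub_Ob_compact : compact P;
  sub_Ar_compact : compact Q
}.

Section Subcategory.
Variables (C : compactCategory) (P : set (Ob C)) (Q : set (Ar C)).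
Hypothesis PQ : is_compact_subcategory P Q.

Let sdom (f : Q) : P := in_set (sub_dom PQ (set_valP f)).
Let scod (f : Q) : P := in_set (sub_cod PQ (set_valP f)).
Let sid (c : P) : Q := in_set (sub_id PQ (set_valP c)).
Let sgf (g f : Q) (gf : sdom g = scod f) : dom (\val g) = cod (\val f) :=
  congr1 val gf.
Let scomp (g f : Q) (gf : sdom g = scod f) : Q :=
  in_set (sub_comp PQ (sgf gf) (set_valP g) (set_valP f)).

Program Definition subcategory : compactCategory :=
  @CompactCategory P Q sdom scod sid scomp _ _ _ _ _ _ _ _ _ _ _ _ _ _ _.
Next Obligation. by move=> c; apply: val_inj; exact: dom_id. Qed.
Next Obligation. by move=> c; apply: val_inj; exact: cod_id. Qed.
Next Obligation. by move=> g f gf; apply: val_inj; exact: dom_comp. Qed.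
Next Obligation. by move=> g f gf; apply: val_inj; exact: cod_comp. Qed.
Next Obligation. by move=> c f cf; apply: val_inj; exact: comp_id_l. Qed.
Next Obligation. by move=> g c gc; apply: val_inj; exact: comp_id_r. Qed.
Next Obligation. by move=> h g f hg gf a b; apply: val_inj; exact: compA. Qed.
Next Obligation. by apply: set_type_compact; exact: sub_Ob_compact PQ. Qed.
Next Obligation. by apply: set_type_hausdorff; exact: Ob_hausdorff. Qed.
Next Obligation. by apply: set_type_compact; exact: sub_Ar_compact PQ. Qed.
Next Obligation. by apply: set_type_hausdorff; exact: Ar_hausdorff. Qed.
Next Obligation.
apply: continuous_into => f; apply: continuous_comp; first exact: val_continuous.
exact: dom_continuous.
Qed.
Next Obligation.
apply: continuous_into => f; apply: continuous_comp; first exact: val_continuous.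
exact: cod_continuous.
Qed.
Next Obligation.
apply: continuous_into => f; apply: continuous_comp; first exact: val_continuous.
exact: idc_continuous.
Qed.
Next Obligation.
set K := (X in set_type X); apply: continuous_into.
pose j (p : K) : @composable C :=
  in_set (sgf (set_valP p) : @composable C (\val (\val p).1, \val (\val p).2)).
have cj : continuous j.
  apply: continuous_into; apply: continuous_pair => p.
    apply: (@continuous_comp K (Q * Q)%type _ \val (fun q => \val q.1)).
      exact: val_continuous.
    apply: (@continuous_comp (Q * Q)%type Q _ fst \val).
      exact: cvg_fst.
    exact: val_continuous.
  apply: (@continuous_comp K (Q * Q)%type _ \val (fun q => \val q.2)).
    exact: val_continuous.
  apply: (@continuous_comp (Q * Q)%type Q _ snd \val).
    exact: cvg_snd.
  exact: val_continuous.
rewrite [X in continuous X](_ : _ = (fun p => comp (set_valP p)) \o j).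
  by move=> p; apply: continuous_comp; [exact: cj|exact: comp_continuous].
by apply: funext => p /=; congr comp; exact: Prop_irrelevance.
Qed.
End Subcategory.

Section Karoubi.
Variable S : compactSemigroupType.

Definition karoubi_ob : set S := [set e | idempotent_elt e].
(** The triple (e,s,f) is an arrow from f to e. *)
Definition karoubi_ar : set (S * S * S) := [set p |
  [/\ karoubi_ob p.1.1, karoubi_ob p.2 & p.1.2 = p.1.1 * p.1.2 * p.2]].

Fact karoubi_arl (p : karoubi_ar) : (\val p).1.1 * (\val p).1.2 = (\val p).1.2.
Proof. by have [e f s] := set_valP p; rewrite s !mulgA e. Qed.
Fact karoubi_arr (p : karoubi_ar) : (\val p).1.2 * (\val p).2 = (\val p).1.2.
Proof. by have [e f s] := set_valP p; rewrite s -!mulgA f. Qed.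
Fact karoubi_dom_subproof (p : karoubi_ar) : karoubi_ob (\val p).2.
Proof. by have [] := set_valP p. Qed.
Fact karoubi_cod_subproof (p : karoubi_ar) : karoubi_ob (\val p).1.1.
Proof. by have [] := set_valP p. Qed.
Fact karoubi_id_subproof (e : karoubi_ob) : karoubi_ar (\val e, \val e, \val e).
Proof. by have ee := set_valP e; split=> //=; rewrite !ee. Qed.
Fact karoubi_comp_subproof (p q : karoubi_ar) :
  karoubi_ar ((\val p).1.1, (\val p).1.2 * (\val q).1.2, (\val q).2).
Proof.
have [e _ _] := set_valP p; have [_ f _] := set_valP q.
by split=> //=; rewrite mulgA karoubi_arl -mulgA karoubi_arr.
Qed.

Let kdom (p : karoubi_ar) : karoubi_ob := in_set (karoubi_dom_subproof p).
Let kcod (p : karoubi_ar) : karoubi_ob := in_set (karoubi_cod_subproof p).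
Let kid (e : karoubi_ob) : karoubi_ar := in_set (karoubi_id_subproof e).
Let kcomp (p q : karoubi_ar) (_ : kdom p = kcod q) : karoubi_ar :=
  in_set (karoubi_comp_subproof p q).

Let tripE (x : S * S * S) : (x.1.1, x.1.2, x.2) = x.
Proof. by case: x => [[]]. Qed.
Let cfst (T U : topologicalType) : continuous (@fst T U).
Proof. by move=> x; exact: cvg_fst. Qed.
Let csnd (T U : topologicalType) : continuous (@snd T U).
Proof. by move=> x; exact: cvg_snd. Qed.
Let ccomp2 (T U W : topologicalType) (f : T -> U) (g : U -> W) :
  continuous f -> continuous g -> continuous (fun x => g (f x)).
Proof. by move=> cf cg x; apply: continuous_comp; [exact: cf|exact: cg]. Qed.
Let cmul (T : topologicalType) (f g : T -> S) :
  continuous f -> continuous g -> continuous (fun x => f x * g x).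
Proof.
move=> cf cg x.
apply: (@continuous_comp T (S * S)%type S (fun x => (f x, g x)) (fun p => p.1 * p.2)).
  exact: continuous_pair.
exact: mulg_continuous.
Qed.
Let c11 : continuous (fun p : S * S * S => p.1.1).
Proof. exact: ccomp2 (@cfst _ _) (@cfst _ _). Qed.
Let c12 : continuous (fun p : S * S * S => p.1.2).
Proof. exact: ccomp2 (@cfst _ _) (@csnd _ _). Qed.
Let c2 : continuous (fun p : S * S * S => p.2).
Proof. exact: csnd. Qed.

Let karoubi_ob_closed : closed karoubi_ob.
Proof.
apply: (closed_eqfun (@cs_hausdorff S)); last by move=> x; exact: cvg_id.
by apply: cmul => x; exact: cvg_id.
Qed.

Let karoubi_ar_closed : closed karoubi_ar.
Proof.
have -> : karoubi_ar = [set p : S * S * S | p.1.1 * p.1.1 = p.1.1] `&`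
    ([set p : S * S * S | p.2 * p.2 = p.2] `&`
     [set p : S * S * S | p.1.2 = p.1.1 * p.1.2 * p.2]).
  by apply/seteqP; split=> p; [case|case=> ? []].
apply: closedI; last apply: closedI; apply: (closed_eqfun (@cs_hausdorff S)) => //.
- exact: cmul.
- exact: cmul.
- by apply: cmul => //; exact: cmul.
Qed.

Program Definition karoubi : compactCategory :=
  @CompactCategory karoubi_ob karoubi_ar kdom kcod kid kcomp
    _ _ _ _ _ _ _ _ _ _ _ _ _ _ _.
Next Obligation. by move=> c; apply: val_inj. Qed.
Next Obligation. by move=> c; apply: val_inj. Qed.
Next Obligation. by move=> g f gf; apply: val_inj. Qed.
Next Obligation. by move=> g f gf; apply: val_inj. Qed.
Next Obligation.
move=> c f cf; have /= ecf := congr1 \val cf; apply: val_inj => /=.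
by rewrite ecf karoubi_arl; exact: tripE.
Qed.
Next Obligation.
move=> g c gc; have /= egc := congr1 \val gc; apply: val_inj => /=.
by rewrite -egc karoubi_arr; exact: tripE.
Qed.
Next Obligation. by move=> h g f hg gf a b; apply: val_inj; rewrite /= mulgA. Qed.
Next Obligation.
apply: set_type_compact; apply: (subclosed_compact karoubi_ob_closed _ (@subsetT _ _)).
exact: cs_compact.
Qed.
Next Obligation. by apply: set_type_hausdorff; exact: cs_hausdorff. Qed.
Next Obligation.
apply: set_type_compact; apply: (subclosed_compact karoubi_ar_closed _ (@subsetT _ _)).
by rewrite -!setXTT; do 2 ?apply: compact_setX; exact: cs_compact.
Qed.
Next Obligation.
by apply: set_type_hausdorff; do 2 ?apply: setX_hausdorff; exact: cs_hausdorff.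
Qed.
Next Obligation.
apply: continuous_into.
exact: (ccomp2 (@val_continuous _ karoubi_ar) c2).
Qed.
Next Obligation.
apply: continuous_into.
exact: (ccomp2 (@val_continuous _ karoubi_ar) c11).
Qed.
Next Obligation.
apply: continuous_into.
apply: (@continuous_pair _ _ _ (fun e : karoubi_ob => (\val e, \val e)) \val).
  by apply: continuous_pair; exact: val_continuous.
exact: val_continuous.
Qed.
Next Obligation.
set K := (X in set_type X); apply: continuous_into.
have v1 : continuous (fun p : K => \val (\val p).1).
  exact: ccomp2 (@val_continuous _ _) (ccomp2 (@cfst _ _) (@val_continuous _ _)).
have v2 : continuous (fun p : K => \val (\val p).2).
  exact: ccomp2 (@val_continuous _ _) (ccomp2 (@csnd _ _) (@val_continuous _ _)).
apply: (@continuous_pair K (S * S)%type S (fun p : K =>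
  ((\val (\val p).1).1.1, (\val (\val p).1).1.2 * (\val (\val p).2).1.2))
  (fun p : K => (\val (\val p).2).2)); [apply: continuous_pair|].
- exact: ccomp2 v1 c11.
- by apply: cmul; [exact: ccomp2 v1 c12|exact: ccomp2 v2 c12].
- exact: ccomp2 v2 c2.
Qed.
End Karoubi.

(** Subshifts.  The alphabet is automatically nonempty, since [pts] is. *)
Definition fullshift (A : finType) := prod_topology (fun _ : int => discrete_topology A).

Definition shift (A : finType) (x : fullshift A) : fullshift A :=
  fun i => x (i + 1)%R.

Record subshift := Subshift {
  alphabet : finType;
  pts : set (fullshift alphabet);
  pts_nonempty : pts !=set0;
  pts_closed : closed pts;
  pts_shift : @shift alphabet @` pts = pts
}.
Arguments pts X : clear implicits, rename.

Fact shift_pts_subproof (X : subshift) (x : pts X) : pts X (shift (\val x)).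
Proof.
by move: (imageP (@shift _) (set_valP x)); rewrite (pts_shift X).
Qed.

Definition shift_pts (X : subshift) (x : pts X) : pts X :=
  in_set (shift_pts_subproof x).

Record subshift_hom (X Y : subshift) := SubshiftHom {
  shom :> pts X -> pts Y;
  shom_continuous : continuous shom;
  shom_shift : forall x, shom (shift_pts x) = shift_pts (shom x)
}.

Lemma subshift_hom_eq (X Y : subshift) (f g : subshift_hom X Y) :
  shom f = shom g -> f = g.
Proof.
case: f g => [f ? ?] [g ? ?] /= ?; subst g.
by f_equal; exact: Prop_irrelevance.
Qed.

Program Definition subshiftCat : category :=
  @Category subshift subshift_hom
    (fun X => @SubshiftHom X X id _ _)
    (fun X Y Z g f => @SubshiftHom X Z (g \o f) _ _) _ _ _.
Next Obligation. by move=> X x; exact: cvg_id. Qed.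
Next Obligation. by []. Qed.
Next Obligation.
by move=> X Y Z g f x; apply: continuous_comp; exact: shom_continuous.
Qed.
Next Obligation. by move=> X Y Z g f x /=; rewrite !shom_shift. Qed.
Next Obligation. by move=> X Y f; exact: subshift_hom_eq. Qed.
Next Obligation. by move=> X Y f; exact: subshift_hom_eq. Qed.
Next Obligation. by move=> *; exact: subshift_hom_eq. Qed.

Definition language (X : subshift) : set (word (alphabet X)) := [set w |
  exists2 x, pts X x & exists i : int, w = [seq x (i + j%:Z)%R | j <- iota 0 (size w)] :> seq _].
Arguments language X : clear implicits.

Definition block (A B : finType) (k : nat) := k.*2.+1.-tuple A -> B.

Definition central_block_map (X Y : subshift) (phi : subshift_hom X Y) (k : nat)
    (Phi : block (alphabet X) (alphabet Y) k) : Prop :=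
  forall (x : pts X) (i : int),
    \val (phi x) i = Phi [tuple \val x (i - k%:Z + j%:Z)%R | j < k.*2.+1].

(** The map \overline\Phi on A^*: [insub] fails exactly when the remaining word
    has length less than 2k+1. *)
Fixpoint block_code (A B : finType) (k : nat) (Phi : block A B k) (w : seq A) : seq B :=
  if w is _ :: w' then
    if insub (take k.*2.+1 w) is Some t then Phi t :: block_code Phi w' else [::]
  else [::].

Section Pseudowords.
Variables (V : set finSemigroupType) (A : finType).
Local Notation F := (freeProV V A).

Fact of_word_subproof (w : word A) : @compatible V A (fun q => vq_map q w).
Proof. by move=> q r h ->. Qed.

Definition of_word (w : word A) : F := in_set (of_word_subproof w).

(** The empty word is sent to I. *)
Definition of_seq (w : seq A) : withI F := omap of_word (insub w).

Definition factor (w : word A) (u : F) : Prop :=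
  exists x y : withI F, Some u = x * Some (of_word w) * y.

(** i_k(u) and t_k(u): when V contains LSl and [u] is an infinite pseudoword,
    [xget] picks the unique word with the stated property. *)
Definition prefix_of (k : nat) (u : F) : seq A := xget [::]
  [set w | size w = k /\ exists v : withI F, Some u = of_seq w * v].
Definition suffix_of (k : nat) (u : F) : seq A := xget [::]
  [set w | size w = k /\ exists v : withI F, Some u = v * of_seq w].
End Pseudowords.
Arguments of_word V {A}.
Arguments of_seq V {A}.

Definition mirage (V : set finSemigroupType) (X : subshift) :
    set (freeProV V (alphabet X)) :=
  [set u | forall w, factor w u -> language X w].
Arguments mirage V X : clear implicits.

Section BlockExtension.
Variables (V : set finSemigroupType) (A B : finType) (k : nat) (Phi : block A B k).

Definition extends_block_code (h : withI (freeProV V A) -> withI (freeProV V B)) :=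
  continuous h /\ forall w : seq A, h (of_seq V w) = of_seq V (block_code Phi w).

(** The continuous extension is unique as A^+ is dense.  The default value is
    the constant I, so that if there were no extension then [PhiK_ob] would
    never be of the form [Some e]. *)
Definition block_ext : withI (freeProV V A) -> withI (freeProV V B) :=
  xget (fun=> None) extends_block_code.

Definition PhiK_ob (e : freeProV V A) : withI (freeProV V B) :=
  block_ext (of_seq V (suffix_of k e) * Some e * of_seq V (prefix_of k e)).

Definition PhiK_mid (e u f : freeProV V A) : withI (freeProV V B) :=
  block_ext (of_seq V (suffix_of k e) * Some u * of_seq V (prefix_of k f)).
End BlockExtension.

Definition mirage_ob (V : set finSemigroupType) (X : subshift) :
  set (Ob (karoubi (freeProV V (alphabet X)))) := [set e | mirage V X (\val e)].
Definition mirage_ar (V : set finSemigroupType) (X : subshift) :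
  set (Ar (karoubi (freeProV V (alphabet X)))) := [set a | mirage V X (\val a).1.2].
Arguments mirage_ob V X : clear implicits.
Arguments mirage_ar V X : clear implicits.

Section MirageKaroubi.
Variables (V : set finSemigroupType) (X : subshift).
Hypothesis HX : is_compact_subcategory (mirage_ob V X) (mirage_ar V X).

Definition mirageK : compactCategory := subcategory HX.

Definition mirageK_ob (c : Ob mirageK) : freeProV V (alphabet X) :=
  \val (\val (c : mirage_ob V X) : karoubi_ob (S := freeProV V (alphabet X))).
Definition mirageK_ar (a : Ar mirageK) :
    freeProV V (alphabet X) * freeProV V (alphabet X) * freeProV V (alphabet X) :=
  \val (\val (a : mirage_ar V X) : karoubi_ar (S := freeProV V (alphabet X))).
End MirageKaroubi.

Definition restricts_PhiK (V : set finSemigroupType) (X Y : subshift)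
    (HX : is_compact_subcategory (mirage_ob V X) (mirage_ar V X))
    (HY : is_compact_subcategory (mirage_ob V Y) (mirage_ar V Y))
    (k : nat) (Phi : block (alphabet X) (alphabet Y) k)
    (G : compactFunctor (mirageK HX) (mirageK HY)) : Prop :=
  (forall c, Some (mirageK_ob (fob G c)) = PhiK_ob Phi (mirageK_ob c)) /\
  (forall a, let: (e, u, f) := mirageK_ar a in
    let: (e', u', f') := mirageK_ar (far G a) in
    [/\ Some e' = PhiK_ob Phi e, Some u' = PhiK_mid Phi e u f
      & Some f' = PhiK_ob Phi f]).

(* Main.v *)
From HB Require Import structures.
Require Import Defs.
From mathcomp Require Import all_boot all_order all_algebra.
From mathcomp Require Import all_classical topology.
From mathcomp Require Import zify.

(** Write M for the free pro-V semigroup with identity I.  The words are dense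
    in M, and since V contains LSl, every language that depends only on the
    prefix, the suffix and the set of factors of length at most L of a word has
    a clopen closure; hence each of these data is locally constant on M, and
    finite factors of pseudowords can be read off on nearby words.

    The block code of wing k extends continuously to M as soon as, for every
    finite quotient r of the free semigroup on B, the map sending w to the value
    in r of its block code is recognized by V = V * D.  The letter read after a
    given suffix produces an element of r, so the value is computed by a
    semidirect product of a power of r by the D-semigroup of suffixes of length
    at most L.  As r need not be a monoid, something must be output while the
    first L letters are read: the state guesses this prefix p in advance and
    outputs a factorization of the value of p into exactly L elements of r,
    which exists for large L because the decreasing chain of the powers of r
    stabilizes.

    If p is a word of length 2k then h (x p y) = h (x p) h (p y) for the extended
    code h, first for words, then by density.  Functoriality on the Karoubi
    envelope, and the compatibility with composition of block maps, follow from
    this identity, applied at p = t_k(f) i_k(f).  Independence of the block map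
    holds because two block maps of a morphism agree, after trimming, on words
    whose short factors all belong to the language of the subshift. *)

Set Implicit Arguments.
Unset Strict Implicit.
Unset Printing Implicit Defensive.

Import GRing.Theory.
Local Open Scope classical_set_scope.
Local Open Scope group_scope.

(** * Quotients of free semigroups *)

Definition word_congruence (A : choiceType) (Z : Type) (g : word A -> Z) :=
  forall u u' v v', g u = g u' -> g v = g v' -> g (u * v) = g (u' * v').

(** Finite semigroups built here live in [Set]: the carriers of members of
    [finSemigroupType] are confined to a universe below that of [finType]. *)
Definition word_quot (A : choiceType) (n : nat) (g : word A -> 'I_n)
  of word_congruence g : Set := {k : nat | `[< exists w, g w = k :> nat >]}.

Section WordQuotient.
Variables (A : choiceType) (n : nat) (g : word A -> 'I_n).
Variable gM : word_congruence g.

Fact word_quot_lt (z : word_quot gM) : sval z < n.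
Proof. by case: z => k kP /=; have /asboolP[w <-] := kP. Qed.

Fact word_quot_pcancel : pcancel (fun z : word_quot gM => Ordinal (word_quot_lt z))
  (fun i : 'I_n => (insub (val i) : option (word_quot gM))).
Proof. by move=> z; rewrite /= -[sval z]/(val z) valK. Qed.

HB.instance Definition _ :=
  Countable.copy (word_quot gM) {k : nat | `[< exists w, g w = k :> nat >]}.
HB.instance Definition _ : isFinite (word_quot gM) := PCanIsFinite word_quot_pcancel.

Definition word_quot_class (w : word A) : word_quot gM :=
  exist _ (val (g w)) (asboolT (ex_intro _ w erefl)).

Lemma word_quot_surj (z : word_quot gM) : exists w, word_quot_class w = z.
Proof. by case: z => z zP; have /asboolP[w wz] := zP; exists w; apply: val_inj. Qed.

(** The product of classes is computed on chosen representatives; [word_congruence] makes the result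
    independent of the choice. *)
Definition word_quot_repr (z : word_quot gM) : word A := sval (cid (word_quot_surj z)).

Lemma word_quot_reprK : cancel word_quot_repr word_quot_class.
Proof. by move=> z; rewrite /word_quot_repr; case: cid. Qed.

Definition word_quot_mul (z z' : word_quot gM) : word_quot gM :=
  word_quot_class (word_quot_repr z * word_quot_repr z').

Lemma word_quot_classM u v :
  word_quot_class (u * v) = word_quot_mul (word_quot_class u) (word_quot_class v).
Proof.
by apply: val_inj => /=; congr nat_of_ord; apply: gM; apply: val_inj;
  exact: (congr1 val (esym (word_quot_reprK (word_quot_class _)))).
Qed.

Fact word_quot_mulA : associative word_quot_mul.
Proof.
move=> x y z; rewrite -[x]word_quot_reprK -[y]word_quot_reprK -[z]word_quot_reprK.
by rewrite -!word_quot_classM mulgA.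
Qed.
HB.instance Definition _ := isSemigroup.Build (word_quot gM) word_quot_mulA.
HB.instance Definition _ := isMultiplicative.Build _ (word_quot gM) word_quot_class
  word_quot_classM.

Lemma word_quot_mulE u v :
  word_quot_class u * word_quot_class v = word_quot_class (u * v).
Proof. by rewrite word_quot_classM. Qed.

Lemma word_quot_class_eq u v : word_quot_class u = word_quot_class v <-> g u = g v.
Proof. by split=> [/(congr1 sval) uv|uv]; apply: val_inj; last by rewrite /= uv. Qed.
End WordQuotient.

Section Vquotients.
Variables (V : set finSemigroupType) (Vpv : pseudovariety V) (A : finType).

(** A [vquotient] must be onto, so [S] is replaced by the image of [f], realized as a quotient of
    the free semigroup by the kernel of [f]. It embeds into [S], hence lies in [V] by [pv_sub]. *)
Lemma vquotient_of_morphism (S : finSemigroupType) (f : {multiplicative word A -> S}) :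
  V S -> exists (q : vquotient V A) (i : {multiplicative q -> S}),
    injective i /\ forall w, i (vq_map q w) = f w.
Proof.
move=> VS.
pose g w := enum_rank (f w).
have gM : word_congruence g.
  by move=> u u' v v' /enum_rank_inj eu /enum_rank_inj ev; rewrite /g !gmulfM eu ev.
pose i0 (z : word_quot gM) : S := f (word_quot_repr z).
have i0E w : i0 (word_quot_class gM w) = f w.
  exact: enum_rank_inj ((word_quot_class_eq gM _ _).1 (word_quot_reprK _)).
have i0M : {morph i0 : x y / x * y}.
  move=> x y; case: (word_quot_surj x) => u <-; case: (word_quot_surj y) => v <-.
  by rewrite -gmulfM !i0E gmulfM.
have i_inj : injective i0.
  move=> x y xy; rewrite -[x]word_quot_reprK -[y]word_quot_reprK.
  by apply/word_quot_class_eq; rewrite /g; congr enum_rank.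
pose iH := isMultiplicative.Build (word_quot gM) S i0 i0M.
pose i : {multiplicative word_quot gM -> S} := HB.pack i0 iH.
have Vq : V (word_quot gM : finSemigroupType) by apply: (pv_sub Vpv (f := i)) VS.
by exists (VQuotient Vq (@word_quot_surj _ _ _ gM)), i.
Qed.

(** Directedness of the inverse system: [s] is the image of the free semigroup in the product of [q]
    and [r]. *)
Lemma vquotient_refinement (q r : vquotient V A) :
  exists (s : vquotient V A) (i : {multiplicative s -> q}) (j : {multiplicative s -> r}),
    [/\ forall w, i (vq_map s w) = vq_map q w, forall w, j (vq_map s w) = vq_map r w &
       forall x y, i x = i y -> j x = j y -> x = y].
Proof.
pose S : finSemigroupType := (vq_sgp q * vq_sgp r)%type.
pose f0 (w : word A) : S := (vq_map q w, vq_map r w).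
have fM : {morph f0 : x y / x * y} by move=> x y; rewrite /f0 !gmulfM.
pose fH := isMultiplicative.Build (word A) S f0 fM.
pose f : {multiplicative word A -> S} := HB.pack f0 fH.
have [s [i [i_inj iE]]] := vquotient_of_morphism f (pv_prod Vpv (vq_mem q) (vq_mem r)).
have i1M : {morph (fun x => (i x).1) : x y / x * y} by move=> x y; rewrite gmulfM.
have i2M : {morph (fun x => (i x).2) : x y / x * y} by move=> x y; rewrite gmulfM.
pose i1H := isMultiplicative.Build s q _ i1M.
pose i2H := isMultiplicative.Build s r _ i2M.
pose i1 : {multiplicative s -> q} := HB.pack (fun x => (i x).1) i1H.
pose i2 : {multiplicative s -> r} := HB.pack (fun x => (i x).2) i2H.
exists s, i1, i2.
split=> /=; [by move=> w; rewrite iE|by move=> w; rewrite iE|].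
by move=> x y e1 e2; apply: i_inj; apply: injective_projections.
Qed.

End Vquotients.

Definition trivial_sgp : Set := unit.
HB.instance Definition _ := Finite.copy trivial_sgp unit.
Fact trivial_sgp_mulA : associative (fun _ _ : trivial_sgp => tt : trivial_sgp).
Proof. by []. Qed.
HB.instance Definition _ := isSemigroup.Build trivial_sgp trivial_sgp_mulA.

Lemma pv_trivial_sgp (V : set finSemigroupType) : pseudovariety V -> V trivial_sgp.
Proof. by move=> Vpv; apply: (pv_one Vpv); rewrite card_unit. Qed.

(** At least one index is needed for the projections to separate the adjoined identity from the
    pseudowords, and for filters indexed by quotients to be proper. *)
Lemma vquotient_exists (V : set finSemigroupType) (A : finType) :
  pseudovariety V -> exists q : vquotient V A, True.
Proof.
move=> Vpv; pose f0 (w : word A) : trivial_sgp := tt.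
have fM : {morph f0 : x y / x * y} by [].
pose fH := isMultiplicative.Build (word A) trivial_sgp f0 fM.
pose f : {multiplicative word A -> trivial_sgp} := HB.pack f0 fH.
by have [q _] := vquotient_of_morphism Vpv f (pv_trivial_sgp Vpv); exists q.
Qed.

(** * Topology of the free pro-V monoid *)

Section WithITopology.
Variable S : compactSemigroupType.

Lemma open_withI (U : set (withI S)) : open U = open (Some @^-1` U).
Proof. by []. Qed.

(** Both values of [b] matter: the identity is isolated, and its complement is open as well. *)
Lemma open_None (b : bool) : open [set x : withI S | (x == None) = b].
Proof.
by rewrite open_withI; case: b; [rewrite (_ : _ @^-1` _ =
  set0)|rewrite (_ : _ @^-1` _ = setT)];
  [exact: open0|apply/seteqP; split|exact: openT|apply/seteqP; split].
Qed.

Lemma Some_continuous : continuous (Some : S -> withI S).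
Proof. by apply/continuousP => U; rewrite open_withI. Qed.

Lemma withI_continuous (T : topologicalType) (f : withI S -> T) :
  continuous (fun s => f (Some s)) -> continuous f.
Proof. by move=> /continuousP cf; apply/continuousP => U /cf; rewrite open_withI. Qed.

Lemma Some_open (U : set S) : open U -> open (Some @` U : set (withI S)).
Proof.
move=> oU; rewrite open_withI (_ : _ @^-1` _ = U) //.
by apply/seteqP; split=> [s [t Ut [<-]]|s Us] //; exists s.
Qed.

Lemma continuous_Some_inv (T : topologicalType) (f : T -> S) :
  continuous (fun t => Some (f t) : withI S) -> continuous f.
Proof.
move=> /continuousP cf; apply/continuousP => U /Some_open /cf.
by congr open; apply/seteqP; split=> [t [s Us [ss]]|t Ut];
  [by rewrite /preimage /= -ss|exists (f t)].
Qed.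

Lemma withI_hausdorff : hausdorff_space (withI S).
Proof.
have nb (x : withI S) (b : bool) : (x == None) = b -> nbhs x [set y | (y == None) = b].
  by move=> xb; apply: open_nbhs_nbhs; split=> //; exact: open_None.
move=> [x|] [y|] // cl.
- congr Some; apply: cs_hausdorff => B C.
  rewrite !nbhsE => -[B' [oB B'x] B'B] [C' [oC C'y] C'C].
  have [||z [[s Bs <-] [t Ct [ts]]]] := cl (Some @` B') (Some @` C').
  + by apply: open_nbhs_nbhs; split; [exact: Some_open|exists x].
  + by apply: open_nbhs_nbhs; split; [exact: Some_open|exists y].
  by exists s; split; [exact: B'B|apply: C'C; rewrite -ts].
- have [z [/= zF zT]] := cl _ _ (nb (Some x) false erefl) (nb None true erefl).
  by rewrite zF in zT.
- have [z [/= zT zF]] := cl _ _ (nb None true erefl) (nb (Some y) false erefl).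
  by rewrite zF in zT.
Qed.

Lemma withI_compact : compact [set: withI S].
Proof.
rewrite (_ : setT = [set None] `|` Some @` [set: S]); last first.
  by apply/seteqP; split=> // -[s|] _; [right; exists s|left].
apply: compactU; first exact: compact_set1.
apply: continuous_compact; last exact: cs_compact.
exact: continuous_subspaceT Some_continuous.
Qed.

Lemma withI_mull_continuous (x : withI S) : continuous (fun y : withI S => x * y).
Proof.
apply: withI_continuous; case: x => [x|] /=; last exact: Some_continuous.
move=> y; apply: (@continuous_comp S S (withI S) (fun y => x * y) Some);
  last exact: Some_continuous.
apply: (@continuous_comp S (S * S)%type S (fun y => (x, y)) (fun p => p.1 * p.2)).
  by apply: cvg_pair; [exact: cvg_cst|exact: cvg_id].
exact: mulg_continuous.
Qed.

Lemma withI_mulr_continuous (x : withI S) : continuous (fun y : withI S => y * x).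
Proof.
apply: withI_continuous; case: x => [x|] /=; last exact: Some_continuous.
move=> y; apply: (@continuous_comp S S (withI S) (fun y => y * x) Some);
  last exact: Some_continuous.
apply: (@continuous_comp S (S * S)%type S (fun y => (y, x)) (fun p => p.1 * p.2)).
  by apply: cvg_pair; [exact: cvg_id|exact: cvg_cst].
exact: mulg_continuous.
Qed.

(** On two elements of [S] this is continuity in [S]; when a factor is the identity, the isolated
    point itself is taken as its neighbourhood and one-sided continuity suffices. *)
Lemma withI_mul_continuous : continuous (fun p : withI S * withI S => p.1 * p.2).
Proof.
have nN : nbhs (None : withI S) [set None].
  apply: open_nbhs_nbhs; split=> //; rewrite (_ : [set None] =
    [set x : withI S | (x == None) = true]).
    exact: open_None.
  by apply/seteqP; split=> x /eqP.
move=> [[x|] y].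
  case: y => [y|] U /= Uxy.
    have := @mulg_continuous S (x, y) _ (Some_continuous Uxy).
    case=> -[P Q] /= [nP nQ] PQ.
    have nS (z : S) (W : set S) : nbhs z W -> nbhs (Some z : withI S) (Some @` W).
      rewrite nbhsE => -[W' [oW W'z] W'W]; apply: filterS (open_nbhs_nbhs (conj
        (Some_open oW) _)); last by exists z.
      by move=> t [s Ws <-]; exists s => //; exact: W'W.
    exists (Some @` P, Some @` Q) => /=; first by split; exact: nS.
    by move=> [a b] [/= [p Pp <-] [q Qq <-]]; exact: (PQ (p, q)).
  exists ([set z : withI S | U (z * (None : withI S))], [set None]) => /=.
    by split=> //; exact: (@withI_mulr_continuous None (Some x) _ Uxy).
  by move=> [a b] [/= Ua ->].
move=> U Uxy; exists ([set None], U) => /=; first by split.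
by move=> [a b] [/= -> Ub].
Qed.
End WithITopology.

Section FreeMonoid.
Variables (V : set finSemigroupType) (A : finType).
Local Notation M := (withI (freeProV V A)).

Lemma of_seq_word (w : word A) : of_seq V w = Some (of_word V w) :> M.
Proof. by rewrite /of_seq valK. Qed.

Lemma of_seq_nil : of_seq V [::] = None :> M.
Proof. by rewrite /of_seq insubF. Qed.

Lemma seq_wordP (w : seq A) : w = [::] \/ exists w' : word A, w = w'.
Proof. by case: w => [|a w]; [left|right; exists (@Word _ (a :: w) isT)]. Qed.

Lemma of_wordM : {morph @of_word V A : x y / x * y}.
Proof.
move=> x y; apply: val_inj; apply: functional_extensionality_dep => q /=.
by rewrite gmulfM.
Qed.

Lemma of_seq_cat (u v : seq A) : of_seq V (u ++ v) = of_seq V u * of_seq V v.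
Proof.
have [->|[u' ->]] := seq_wordP u; first by rewrite of_seq_nil mul1g.
have [->|[v' ->]] := seq_wordP v; first by rewrite of_seq_nil cats0 mulg1.
by rewrite -[_ ++ _]/(wval (u' * v')) !of_seq_word of_wordM.
Qed.

(** The projection onto [q] with an identity adjoined; [None] is reached only from [None], so the
    empty word is never confused with a nonempty one. *)
Definition pr (q : vquotient V A) (x : M) : option q := omap (fun u => \val u q) x.

Lemma pr_of_seq q (w : seq A) : pr q (of_seq V w) = omap (vq_map q) (insub w).
Proof. by rewrite /pr /of_seq; case: insub. Qed.

Lemma pr_dense q (x : M) : exists w : seq A, pr q (of_seq V w) = pr q x.
Proof.
case: x => [u|]; last by exists [::]; rewrite of_seq_nil.
by have [w wu] := vq_surj (\val u q); exists w; rewrite of_seq_word /= -wu.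
Qed.

Lemma pr_continuous (q : vquotient V A) : continuous (fun u : freeProV V A =>
  \val u q : discrete_topology q).
Proof.
move=> u; apply: (@continuous_comp (freeProV V A) (vq_prod V A) _ _ (fun y => y q)).
  exact: val_continuous.
exact: vq_proj_continuous.
Qed.

Lemma open_pr (q : vquotient V A) (P : option q -> Prop) : open [set x : M | P (pr q x)].
Proof.
rewrite open_withI; have /continuousP h := @pr_continuous q.
exact: (h [set s | P (Some s)] (@discrete_open (discrete_topology q) _)).
Qed.

Lemma nbhs_pr q (x : M) : nbhs x [set y : M | pr q y = pr q x].
Proof.
by apply: open_nbhs_nbhs; split=> //; exact: (@open_pr q (fun z => z = pr q x)).
Qed.

Hypothesis Vpv : pseudovariety V.

Lemma pr_refine (q r : vquotient V A) : exists s : vquotient V A,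
  forall x y : M, pr s x = pr s y -> pr q x = pr q y /\ pr r x = pr r y.
Proof.
have [s [i [j [iE jE _]]]] := vquotient_refinement Vpv q r; exists s.
case=> [u|] [v|] // [uv]; have compatP (x : freeProV V A) : compatible (\val x) :=
  set_valP x.
have iP x := compatP x _ _ _ iE; have jP x := compatP x _ _ _ jE.
by split; rewrite /= -?iP -?jP; congr (Some (_ _)).
Qed.

Lemma pr_inj (x y : M) : (forall q, pr q x = pr q y) -> x = y.
Proof.
have [q0 _] := vquotient_exists A Vpv.
case: x y => [u|] [v|] // uv; [|by have := uv q0|by have := uv q0].
congr Some; apply: val_inj; apply: functional_extensionality_dep => q.
by have [] := uv q.
Qed.

(** The fibres of the projections form a neighbourhood base. Otherwise, by directedness, the sets
    [B q] generate a proper filter; by compactness it has a cluster point, which shares every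
    projection with [x], so equals [x], although all the [B q] avoid the neighbourhood [W]. *)
Lemma nbhs_prP (x : M) (U : set M) : nbhs x U ->
  exists q, forall y : M, pr q y = pr q x -> U y.
Proof.
rewrite nbhsE => -[W [oW Wx] WU]; apply: contrapT => nU.
pose B q := [set y : M | pr q y = pr q x /\ ~ W y].
have B0 q : B q !=set0.
  apply: contrapT => nB; apply: nU; exists q => y yx; apply: WU; apply: contrapT => nWy.
  by apply: nB; exists y.
have [q0 _] := vquotient_exists A Vpv.
have FB : ProperFilter (filter_from setT B).
  apply: filter_from_proper => //; apply: filter_from_filter; first by exists q0.
  move=> q r _ _; have [s sP] := pr_refine q r; exists s => // y [yx nWy].
  by have [] := sP _ _ yx.
have [|p [_ clp]] := @withI_compact (freeProV V A) _ FB; first exact: filterT.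
have px : p = x.
  apply: pr_inj => q; have [|z [[zx _] zp]] := clp (B q) _ _ (nbhs_pr q p);
    first by exists q.
  by rewrite -zx -zp.
have nW : nbhs p W by rewrite px; exact: open_nbhs_nbhs.
by have [|z [[_ nWz] Wz] //] := clp (B q0) W _ nW; first by exists q0.
Qed.

(** * Closures of recognized languages *)

Definition wcl (P : set (seq A)) : set M := closure (of_seq V @` P).

(** Recognition for an arbitrary function on words; a language is the case where [T] is [Prop]. *)
Definition recognized (T : Type) (g : seq A -> T) := exists q : vquotient V A,
  forall u v, pr q (of_seq V u) = pr q (of_seq V v) -> g u = g v.

Lemma recognized_pair (T U : Type) (g : seq A -> T) (h : seq A -> U) :
  recognized g -> recognized h -> recognized (fun w => (g w, h w)).
Proof.
move=> [q qP] [r rP]; have [s sP] := pr_refine q r; exists s => u v /sP [uv uv'].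
by rewrite (qP _ _ uv) (rP _ _ uv').
Qed.

Lemma recognized_morphism (S : finSemigroupType) (f : {multiplicative word A -> S}) :
  V S -> recognized (fun w => omap f (insub w)).
Proof.
move=> VS; have [q [i [_ iE]]] := vquotient_of_morphism Vpv f VS.
exists q => u v; rewrite !pr_of_seq.
by case: insub => [u'|]; case: insub => [v'|] //= [uv]; rewrite -!iE uv.
Qed.

Lemma wcl_sub (P : set (seq A)) (w : seq A) : P w -> wcl P (of_seq V w).
Proof. by move=> Pw; apply: subset_closure; exists w. Qed.

Lemma wcl_min (P : set (seq A)) (C : set M) (x : M) : closed C ->
  (forall w, P w -> C (of_seq V w)) -> wcl P x -> C x.
Proof.
move=> cC PC clx; apply: cC => U nU; have [z [[w Pw <-] Uw]] := clx U nU.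
by exists (of_seq V w); split=> //; exact: PC.
Qed.

Lemma wclT (x : M) : wcl setT x.
Proof.
move=> U /nbhs_prP [q qU]; have [w wx] := pr_dense q x.
by exists (of_seq V w); split; [exists w|exact: qU].
Qed.

Arguments wclT : clear implicits.

Lemma dense_ind (C : set M) : closed C -> (forall w, C (of_seq V w)) -> forall x, C x.
Proof. by move=> cC Cw x; apply: (wcl_min cC _ (wclT x)) => w _. Qed.

(** Words close to [x] have the projection of [x] to the recognizing quotient, hence a common value
    of [g]. *)
Lemma recognized_fiber (T : Type) (g : seq A -> T) (x : M) :
  recognized g -> exists w, wcl [set v | g v = g w] x.
Proof.
move=> [q qP]; have [w wx] := pr_dense q x; exists w => U nU.
have [z [[v _ <-] [Uz vx]]] := wclT x _ (filterI nU (nbhs_pr q x)).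
by exists (of_seq V v); split=> //; exists v => //; apply: qP; rewrite wx.
Qed.

(** Approximating [x] by a word of [P] and by a word of [Q] with the same projection to the quotient
    recognizing [P] puts the second word in [P] too. *)
Lemma recognized_wcl (P Q : set (seq A)) (x : M) : recognized P ->
  wcl P x -> wcl Q x -> exists2 w, P w & Q w.
Proof.
move=> [q qP] Px Qx; have [_ [[u Pu <-] ux]] := Px _ (nbhs_pr q x).
have [_ [[v Qv <-] vx]] := Qx _ (nbhs_pr q x).
by exists v; [rewrite (qP v u) //; move: ux vx => /= -> ->|].
Qed.

Lemma wcl_of_seq (P : set (seq A)) (w : seq A) : recognized P -> wcl P (of_seq V w) ->
  P w.
Proof.
move=> rP Pw; apply: contrapT => nPw.
by have [v Pv nPv] := recognized_wcl rP Pw (@wcl_sub (~` P) w nPw).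
Qed.

(** The closures of [P] and of its complement cover the monoid by [recognized_fiber] and are
    disjoint by [recognized_wcl], so each is clopen. *)
Lemma wcl_open (P : set (seq A)) : recognized P -> open (wcl P).
Proof.
move=> rP; rewrite -[X in open X]setCK openC (_ : ~` _ = wcl (~` P)).
  exact: closed_closure.
apply/seteqP; split=> x; last by move=> nPx Px; have [] := recognized_wcl rP Px nPx.
have [w wx] := recognized_fiber x rP.
have [Pw|nPw] := pselect (P w) => nPx.
  by case: nPx; apply: (wcl_min _ _ wx); [exact: closed_closure|move=> v /= vw;
    apply: wcl_sub; rewrite vw].
by apply: (wcl_min _ _ wx); [exact: closed_closure|move=> v /= vw;
  apply: wcl_sub => Pv; apply: nPw; rewrite -vw].
Qed.

End FreeMonoid.
Arguments wcl V {A}.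
Arguments recognized V {A T}.

(** * Locally testable languages *)

Section Infixes.
Variable A : eqType.
Implicit Types s t u v w : seq A.

Lemma prefix_catP t u v : prefix t (u ++ v) ->
  prefix t u \/ exists2 t2, t = u ++ t2 & prefix t2 v.
Proof.
elim: u t => [|a u IH] [|b t] /=; try by left.
  by move=> tv; right; exists (b :: t).
case/andP=> /eqP -> /IH [tu|[t2 -> t2v]]; first by left; rewrite eqxx.
by right; exists t2.
Qed.

Lemma infix_catP t u v : infix t (u ++ v) ->
  [\/ infix t u, infix t v | exists t1 t2, [/\ t = t1 ++ t2, suffix t1 u & prefix t2 v]].
Proof.
elim: u => [|a u IH]; first by constructor 2.
rewrite cat_cons infix_consl -cat_cons; case/orP=> [/prefix_catP [tu|[t2 -> t2v]]|/IH].
- by constructor 1; rewrite infix_consl tu.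
- by constructor 3; exists (a :: u), t2; split=> //; exact: suffix_refl.
- case=> [tu|tv|[t1 [t2 [-> t1u t2v]]]]; [by constructor 1;
  rewrite infix_consl tu orbT|by constructor 2|].
  by constructor 3; exists t1, t2; split=> //; rewrite -cat1s; exact: suffix_catr.
Qed.

Lemma infix_cat_split t1 t2 u v : suffix t1 u -> prefix t2 v -> infix (t1 ++ t2) (u ++ v).
Proof.
move=> /suffixP [u' ->] /prefixP [v' ->].
by apply/infixP; exists u', v'; rewrite !catA.
Qed.

(** A factor no longer than [w] cannot stick out of [w] on both sides. *)
Lemma infix_mid t u w v : size t <= size w -> infix t (u ++ w ++ v) ->
  infix t (u ++ w) \/ infix t (w ++ v).
Proof.
move=> tw /infix_catP [tu|twv|[t1 [t2 [et t1u /prefix_catP[t2w|[t3 et2 _]]]]]].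
- by left; exact: infix_catr.
- by right.
- by left; rewrite et; exact: infix_cat_split.
(* Here [t] is [t1 ++ w ++ t3], and the bound on its size forces [t1] and [t3] to be empty. *)
- left; suff -> : t = w by exact: suffix_infix.
  move: tw; rewrite et et2 !size_cat => tw.
  have /size0nil -> : size t1 = 0%N by lia.
  have /size0nil -> : size t3 = 0%N by lia.
  by rewrite cats0.
Qed.

Lemma prefix_take_le t w L : size t <= L -> prefix t w = prefix t (take L w).
Proof. by move=> tL; rewrite !prefixE take_takel. Qed.

(** Suffixes are compared as prefixes of the reversals. For words shorter than [L] the first clause
    is equality. *)
Definition locally_eq (L : nat) u v := [/\ take L u = take L v,
  take L (rev u) = take L (rev v) & forall t, size t <= L -> infix t u = infix t v].

Lemma locally_eq_sym L u v : locally_eq L u v -> locally_eq L v u.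
Proof. by case=> p s i; split=> // t /i. Qed.

Lemma locally_eq_prefix L u v t : locally_eq L u v -> size t <= L ->
  prefix t u = prefix t v.
Proof. by case=> p _ _ tL; rewrite (prefix_take_le u tL) (prefix_take_le v tL) p. Qed.

Lemma locally_eq_suffix L u v t : locally_eq L u v -> size t <= L ->
  suffix t u = suffix t v.
Proof.
case=> _ s _; rewrite -(size_rev t) -!prefix_rev => tL.
by rewrite (prefix_take_le (rev u) tL) (prefix_take_le (rev v) tL) s.
Qed.

(** The strict bound is essential: the equal prefixes have length less than [L], so neither word was
    truncated. *)
Lemma locally_eq_small L u v : locally_eq L u v -> size u < L -> u = v.
Proof.
case=> p _ _ uL; have := congr1 size p; rewrite !size_take_min => sp.
by move: p; rewrite !take_oversize //; lia.
Qed.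

Lemma take_cat_congr L u u' v v' : take L u = take L u' -> take L v = take L v' ->
  take L (u ++ v) = take L (u' ++ v').
Proof.
move=> eu ev; have := congr1 size eu; rewrite !size_take_min => su.
have [Lu|uL] := leqP L (size u); first by rewrite (takel_cat _ Lu) takel_cat //;
  move: su Lu; lia.
have <- : u = u' by move: eu; rewrite !take_oversize //; lia.
rewrite !take_cat !ltnNge (ltnW uL) /=; congr cat.
by rewrite -(@take_takel _ _ L) ?leq_subr // ev take_takel // leq_subr.
Qed.

(** A factor astride the junction is a suffix of [u] followed by a prefix of [v], both of length at
    most [L], and these are visible in [u'] and [v']. *)
Lemma locally_eq_cat L u u' v v' : locally_eq L u u' -> locally_eq L v v' ->
  locally_eq L (u ++ v) (u' ++ v').
Proof.
wlog suff H : u u' v v' / locally_eq L u u' -> locally_eq L v v' ->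
    forall t, size t <= L -> infix t (u ++ v) -> infix t (u' ++ v').
  move=> eu ev; case: (eu) (ev) => [pu su _] [pv sv _]; split.
  - exact: take_cat_congr.
  - by rewrite !rev_cat; exact: take_cat_congr.
  - by move=> t tL; apply/idP/idP; apply: H => //; exact: locally_eq_sym.
move=> eu ev t tL; case/infix_catP => [tu|tv|[t1 [t2 [et t1u t2v]]]].
- by case: eu => _ _ i; apply: infix_catr; rewrite -i.
- by case: ev => _ _ i; apply: infix_catl; rewrite -i.
- have sL : size t1 <= L /\ size t2 <= L by move: tL; rewrite et size_cat; lia.
  rewrite et; apply: infix_cat_split.
    by rewrite -(locally_eq_suffix eu) //; case: sL.
  by rewrite -(locally_eq_prefix ev) //; case: sL.
Qed.

(** The local semilattice laws at an idempotent class. As [w] has length at least [L], it fixes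
    prefixes and suffixes, and by [infix_mid] each short factor lies in [w ++ x ++ w] or in
    [w ++ y ++ w]; union of sets of factors is commutative and idempotent. *)
Lemma locally_eq_idempotent L w x y : w <> [::] -> locally_eq L (w ++ w) w ->
  locally_eq L (w ++ x ++ w ++ w ++ y ++ w) (w ++ y ++ w ++ w ++ x ++ w) /\
  locally_eq L (w ++ x ++ w ++ w ++ x ++ w) (w ++ x ++ w).
Proof.
move=> w0 [p _ i]; have Lw : L <= size w.
  have := congr1 size p; rewrite !size_take_min size_cat.
  by case: (w) w0 => //= *; lia.
have pw s : take L (w ++ s) = take L w by rewrite takel_cat.
have sw s : take L (rev (s ++ w)) = take L (rev w) by rewrite rev_cat takel_cat ?size_rev.
have I t x' y' : size t <= L -> infix t (w ++ x' ++ w ++ w ++ y' ++ w) =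
    infix t (w ++ x' ++ w) || infix t (w ++ y' ++ w).
  move=> tL; apply/idP/idP => [|/orP[h|h]]; last 2 first.
  - rewrite (_ : _ ++ _ = (w ++ x' ++ w) ++ w ++ y' ++ w); first exact: infix_catr.
    by rewrite -!catA.
  - rewrite (_ : _ ++ _ = (w ++ x' ++ w) ++ w ++ y' ++ w); first exact: infix_catl.
    by rewrite -!catA.
  have tw := leq_trans tL Lw.
  rewrite catA => /(infix_mid tw) [|/(@infix_mid t w w _ tw) []].
  - by rewrite -catA => ->.
  - by rewrite i // => ti; rewrite infix_catr.
  - by move=> ->; rewrite orbT.
by split; split; rewrite ?pw // ?catA ?sw // => t tL; rewrite -?catA !I // ?orbb // orbC.
Qed.
End Infixes.

(** A finite-type invariant whose fibres are the classes of [locally_eq L]; it makes the quotient by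
    this congruence finite. *)
Definition profile (A : finType) (L : nat) (w : seq A) :
    (L.-bseq A * L.-bseq A * {set L.-bseq A})%type :=
  (insub_bseq L (take L w), insub_bseq L (take L (rev w)),
    [set t : L.-bseq A | infix t w]%SET).

Lemma profile_eqP (A : finType) L (u v : seq A) :
  profile L u = profile L v <-> locally_eq L u v.
Proof.
have bs (s : seq A) : val (insub_bseq L (take L s)) = take L s.
  by rewrite insubdK // unfold_in size_take_min geq_minl.
split=> [[p s i]|[p s i]].
  split; [by rewrite -bs p bs|by rewrite -bs s bs|move=> t tL].
  by have /setP/(_ (Bseq tL)) := i; rewrite !inE.
by congr (_, _, _); [rewrite p|rewrite s|apply/setP=> t; rewrite !inE i // size_bseq].
Qed.

Lemma wvalM (A : choiceType) (u v : word A) : wval (u * v) = wval u ++ wval v.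
Proof. by []. Qed.

Section Testable.
Variables (V : set finSemigroupType) (Vpv : pseudovariety V) (LSlV : LSl `<=` V).
Variable A : finType.

(** The quotient by [locally_eq L] is in [LSl] by [locally_eq_idempotent], hence in [V]. *)
Lemma recognized_profile L : recognized V (@profile A L).
Proof.
pose g (w : word A) := enum_rank (profile L w).
have gP u v : g u = g v <-> locally_eq L u v.
  by rewrite -profile_eqP; split=> [/enum_rank_inj|uv] //; rewrite /g uv.
have gM : word_congruence g.
  by move=> u u' v v' /gP eu /gP ev; apply/gP; exact: locally_eq_cat.
have cP u v : word_quot_class gM u = word_quot_class gM v <-> locally_eq L u v.
  by rewrite word_quot_class_eq gP.
have LQ : LSl (word_quot gM : finSemigroupType).
  move=> e; have [w <-] := word_quot_surj e; rewrite /idempotent_elt !word_quot_mulE =>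
    /cP ww.
  have w0 : wval w <> [::] by case: (w) => [[]].
  have m2 := word_quot_mulE gM.
  have m3 z : word_quot_class gM w * word_quot_class gM z * word_quot_class gM w =
      word_quot_class gM (w * z * w) by rewrite m2 (m2 (w * z) w).
  split=> x => [y|]; have [x' <-] := word_quot_surj x.
    have [y' <-] := word_quot_surj y; rewrite !m3 !m2; apply/cP.
    by have [+ _] := locally_eq_idempotent x' y' w0 ww; rewrite !wvalM -!catA.
  rewrite !m3 !m2; apply/cP.
  by have [_ +] := locally_eq_idempotent x' x' w0 ww; rewrite !wvalM -!catA.
exists (VQuotient (LSlV LQ) (@word_quot_surj _ _ _ gM)) => u v; rewrite !pr_of_seq.
have [->|[u' ->]] := seq_wordP u; have [->|[v' ->]] := seq_wordP v;
  rewrite ?valK ?insubF //=.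
move=> uv; apply/profile_eqP; apply: (cP _ _).1.
exact: (congr1 (odflt (word_quot_class gM u')) uv).
Qed.

Lemma recognized_testable (T : Type) (g : seq A -> T) L :
  (forall u v, locally_eq L u v -> g u = g v) -> recognized V g.
Proof.
move=> gL; have [q qP] := recognized_profile L.
by exists q => u v /qP /profile_eqP /gL.
Qed.

Lemma recognized_infix t : recognized V [set w : seq A | infix t w].
Proof. by apply: (@recognized_testable _ _ (size t)) => u v [_ _ i] /=;
  rewrite /mkset i. Qed.

Lemma recognized_prefix t : recognized V [set w : seq A | prefix t w].
Proof.
apply: (@recognized_testable _ _ (size t)) => u v uv; rewrite /mkset.
by rewrite (locally_eq_prefix uv).
Qed.

Lemma recognized_suffix t : recognized V [set w : seq A | suffix t w].
Proof.
apply: (@recognized_testable _ _ (size t)) => u v uv; rewrite /mkset.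
by rewrite (locally_eq_suffix uv).
Qed.

Lemma recognized_set1 t : recognized V [set t : seq A].
Proof.
(* One more than the size of [t], to meet the strict bound of [locally_eq_small]. *)
apply: (@recognized_testable _ _ (size t).+1) => u v uv; apply: propext; split=> /= h.
  by rewrite -(locally_eq_small uv) // h.
by rewrite -(locally_eq_small (locally_eq_sym uv)) // h.
Qed.

(** Singletons are recognized, so the closure of [[set u]] contains no other word. *)
Lemma of_seq_inj : injective (of_seq V : seq A -> _).
Proof.
move=> u v uv; apply: esym; apply: (wcl_of_seq (recognized_set1 u) (w := v)).
by rewrite -uv; exact: wcl_sub.
Qed.
End Testable.

(** * Continuous extension of block codes *)

Section Extension.
Variables (V : set finSemigroupType) (Vpv : pseudovariety V) (A B : finType).
Local Notation MA := (withI (freeProV V A)).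
Local Notation MB := (withI (freeProV V B)).

(** The value at [x] of the future extension of [g]. Its coordinate at [r] is read on a word [W r]
    close enough to [x]; any two coordinates can be read on one common word, whence
    compatibility. *)
Lemma recognized_limit (g : seq A -> MB) (x : MA) :
  (forall r : vquotient V B, recognized V (fun w => pr r (g w))) ->
  exists y : MB, forall r, exists q, forall w,
    pr q (of_seq V w) = pr q x -> pr r (g w) = pr r y.
Proof.
move=> /choice[Q QP]; have /choice[W WP] r := pr_dense (Q r) x.
have common r r' : exists w, pr r (g w) = pr r (g (W r)) /\ pr r' (g w) =
  pr r' (g (W r')).
  have [s sP] := pr_refine Vpv (Q r) (Q r'); have [w wx] := pr_dense s x.
  have [wr wr'] := sP _ _ wx; exists w.
  by split; apply: QP; rewrite WP.
suff [y yP] : exists y, forall r, pr r (g (W r)) = pr r y.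
  exists y => r; exists (Q r) => w wx; rewrite -yP.
  by apply: QP; rewrite WP.
(* One coordinate decides whether the limit is the identity; [common] carries the decision to all
   the others. *)
have [r0 _] := vquotient_exists B Vpv.
case e0: (g (W r0)) => [y0|]; last first.
  exists None => r; have [w [<-]] := common r r0; rewrite e0.
  by case: (g w).
(* The default [y0] only serves to remove [Some]: no [g (W r)] is [None] in this case. *)
have yP r : g (W r) = Some (odflt y0 (g (W r))).
  have [w [+ +]] := common r r0; rewrite e0.
  by case: (g w); case: (g (W r)).
have yc : compatible (fun r => \val (odflt y0 (g (W r))) r).
  move=> r r' h hP; have [w [+ +]] := common r r'.
  rewrite yP (yP r'); case: (g w) => //= z [<-] [<-].
  exact: (set_valP z _ _ _ hP).
exists (Some (Defs.in_set yc)) => r.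
by rewrite yP.
Qed.

(** For continuity at [x], a point [y] in the fibre attached to [x] and [r] is approximated by a
    word that computes the [r]-coordinate of both [h x] and [h y]. *)
Lemma recognized_extension (g : seq A -> MB) :
  (forall r : vquotient V B, recognized V (fun w => pr r (g w))) ->
  exists h : MA -> MB, continuous h /\ forall w, h (of_seq V w) = g w.
Proof.
move=> gr; have /choice[h hP] x := recognized_limit x gr; exists h; split=> [x U|w].
  move=> /(nbhs_prP Vpv) [r rU]; have [q qP] := hP x r.
  apply: filterS (nbhs_pr q x) => y /= yx; apply: rU.
  have [q' qP'] := hP y r; have [s sP] := pr_refine Vpv q q'.
  have [w wy] := pr_dense s y; have [wq wq'] := sP _ _ wy.
  by rewrite -(qP w) ?wq // -(qP' w).
apply: (pr_inj Vpv) => r; have [q qP] := hP (of_seq V w) r.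
by rewrite -(qP w).
Qed.
End Extension.

(** * Combinatorics of block codes *)

Section BlockCode.
Variables (A B : finType) (k : nat) (Phi : block A B k).
Implicit Types u v w x y p : seq A.

Lemma block_code_small w : size w <= k.*2 -> block_code Phi w = [::].
Proof.
case: w => //= a w aw; case: insubP => //= t _ tE.
by have := size_tuple t; rewrite tE /= size_take_min; move: aw => /=; lia.
Qed.

Lemma block_code_cons a w (t : k.*2.+1.-tuple A) : take k.*2.+1 (a :: w) = t ->
  block_code Phi (a :: w) = Phi t :: block_code Phi w.
Proof. by rewrite [block_code _ _]/=/= => ->; rewrite valK. Qed.

Lemma take_tupleP n w : n <= size w -> exists t : n.-tuple A, take n w = t.
Proof. by move=> nw; exists (@Tuple n A (take n w) (introT eqP (size_takel nw))). Qed.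

Lemma size_block_code w : size (block_code Phi w) = (size w - k.*2)%N.
Proof.
elim: w => // a w IH; have [aw|aw] := leqP (size (a :: w)) k.*2.
  by rewrite block_code_small //; apply/esym/eqP; rewrite subn_eq0.
have [t tE] := take_tupleP aw; rewrite (block_code_cons tE) /= IH.
by rewrite subSn.
Qed.

(** Each window of width [2k+1] in [x ++ p ++ y] lies in exactly one of [x ++ p] and [p ++ y],
    because the overlap [p] is one letter too short to contain a window. *)
Lemma block_code_cat x p y : size p = k.*2 ->
  block_code Phi (x ++ p ++ y) = block_code Phi (x ++ p) ++ block_code Phi (p ++ y).
Proof.
move=> sp; elim: x => [|a x IH]; first by rewrite (@block_code_small ([::] ++ p)) ?sp.
have s1 : k.*2.+1 <= size ((a :: x) ++ p) by rewrite size_cat sp /=; lia.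
have [t tE] := take_tupleP s1.
rewrite catA !cat_cons (block_code_cons (t := t)) ?(block_code_cons (t := t)) //.
  by rewrite -catA IH.
by rewrite -!cat_cons takel_cat.
Qed.

Lemma block_code_word (t : k.*2.+1.-tuple A) : block_code Phi t = [:: Phi t].
Proof.
case: t => -[|a w] tP //; have sw := eqP tP.
rewrite (block_code_cons (t := Tuple tP)) ?block_code_small //;
  last by rewrite take_oversize ?sw.
by move: sw => /= [->].
Qed.
End BlockCode.

(** * Products of prescribed length in a finite semigroup *)

Section Products.
Variable S : finSemigroupType.

Fixpoint sgprod (c : nat -> S) (n : nat) : S :=
  if n is m.+1 then sgprod c m * c m.+1 else c 0%N.

Lemma eq_sgprod c d n : (forall i, i <= n -> c i = d i) -> sgprod c n = sgprod d n.
Proof.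
elim: n => [|n IH] cd /=; first exact: cd.
by rewrite IH ?cd // => i ni; apply: cd; lia.
Qed.

(** [n.+1] factors, since [S] need not have a unit. *)
Definition factorizable n (s : S) := exists c, s = sgprod c n.

Lemma factorizable0 s : factorizable 0 s.
Proof. by exists (fun=> s). Qed.

Lemma factorizableM n s t : factorizable n s -> factorizable n.+1 (s * t).
Proof.
move=> [c ->]; exists (fun i => if i <= n then c i else t) => /=.
by rewrite ltnn; congr (_ * _); apply: eq_sgprod => i ->.
Qed.

Lemma factorizableS n s : factorizable n.+1 s -> exists s' t,
  factorizable n s' /\ s = s' * t.
Proof. by move=> [c ->]; exists (sgprod c n), (c n.+1); split=> //; exists c. Qed.

Lemma factorizable_decr n s : factorizable n.+1 s -> factorizable n s.
Proof.
elim: n s => [|n IH] s /factorizableS [s' [t [fs ->]]]; first exact: factorizable0.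
by apply: factorizableM; exact: IH.
Qed.

(** The sets of products of [n.+1] elements decrease with [n]; if every inclusion were strict, the
    first set would have more elements than its cardinality. *)
Lemma factorizable_stable : exists m, forall s, factorizable m s -> factorizable m.+1 s.
Proof.
apply: contrapT => nst; pose P n := [set s : S | `[< factorizable n s >]]%SET.
have dec n : #|P n.+1| < #|P n|.
  apply: proper_card; apply/properP; split.
    by apply/fintype.subsetP => s; rewrite !inE; exact: factorizable_decr.
  apply: contrapT => PS; apply: nst; exists n => s fs; apply: contrapT => nfs.
  by apply: PS; exists s; rewrite inE //; apply/negP; rewrite inE.
have bound n : #|P n| + n <= #|P 0%N|.
  by elim: n => [|n IH]; [rewrite addn0|have := dec n; lia].
by have := bound #|P 0%N|.+1; lia.
Qed.

(** Once two consecutive sets coincide, all later ones do: split off the last factor and lengthen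
    the rest. *)
Lemma factorizable_incr : exists m, forall i j s, m <= i -> i <= j ->
  factorizable i s -> factorizable j s.
Proof.
have [m mP] := factorizable_stable; exists m => i j s mi ij fi.
have step n : m <= n -> forall s, factorizable n s -> factorizable n.+1 s.
  elim: n => [|n IH]; first by rewrite leqn0 => /eqP m0; rewrite -m0.
  rewrite leq_eqVlt => /orP[/eqP <- //|mn] s' /factorizableS [s'' [t [fs ->]]].
  by apply: factorizableM; exact: IH.
elim: j ij => [|j IH]; first by rewrite leqn0 => /eqP <-.
rewrite leq_eqVlt => /orP[/eqP <- //|ij]; apply: step; [lia|exact: IH].
Qed.
End Products.

Section LetterWords.
Variable A : choiceType.

Definition letter (a : A) : word A := @Word A [:: a] isT.

Lemma word_rcons_ind (P : word A -> Prop) : (forall a, P (letter a)) ->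
  (forall w a, P w -> P (w * letter a)) -> forall w, P w.
Proof.
move=> P1 PS [w wP]; elim/last_ind: w wP => [//|[|b w] a IH] wP.
  by rewrite (_ : Word wP = letter a) //; exact: val_inj.
have -> : Word wP = @Word A (b :: w) isT * letter a.
  by apply: val_inj; rewrite /= cats1.
exact/PS/IH.
Qed.

(** Universal property of the free semigroup. The product is folded from the value of the first
    letter since [S] has no unit; the proof carried by the word excludes the empty case. *)
Lemma word_lift (S : semigroupType) (f : A -> S) :
  exists F : {multiplicative word A -> S}, forall a, F (letter a) = f a.
Proof.
pose F0 (w : word A) : S := match w with
  | Word s p => (match s return ~~ nilp s -> S with
    | [::] => fun p => False_rect S (Bool.diff_false_true p)
    | a :: s' => fun=> foldl (fun t b => t * f b) (f a) s' end) p end.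
have F0M : {morph F0 : x y / x * y}.
  case=> [[|a u] uP] // [[|b v] vP] //=; rewrite foldl_cat /=.
  move: (foldl _ _ u) => s; elim/last_ind: v {vP} => //= v c IH.
  by rewrite !foldl_rcons IH mulgA.
pose FH := isMultiplicative.Build (word A) S F0 F0M.
by exists (HB.pack_for {multiplicative word A -> S} F0 FH).
Qed.
End LetterWords.

Lemma factorizable_word (A : finType) (S : finSemigroupType)
  (F : {multiplicative word A -> S}) (w : word A) : factorizable (size w).-1 (F w).
Proof.
elim/word_rcons_ind: w => [a|w a IH]; first exact: factorizable0.
have -> : (size (w * letter a)).-1 = (size w).-1.+1.
  by rewrite wvalM size_cat /=; case: (w) => [[]] //= *; rewrite addn1.
by rewrite gmulfM; exact: factorizableM.
Qed.

Section Power.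
Variable S : finSemigroupType.

(** The power of [S] as an iterated binary product, the form to which [pv_prod] applies. *)
Fixpoint sgpow (n : nat) : finSemigroupType :=
  if n is m.+1 then (S * sgpow m)%type : finSemigroupType else trivial_sgp.

Fixpoint powmk (n : nat) : ('I_n -> S) -> sgpow n :=
  if n is m.+1 return ('I_n -> S) -> sgpow n
  then fun f => (f ord0, powmk (fun i => f (lift ord0 i))) else fun=> tt.

Fixpoint powget (n : nat) : sgpow n -> 'I_n -> S :=
  if n is m.+1 return sgpow n -> 'I_n -> S
  then fun x i => if unlift ord0 i is Some j then powget x.2 j else x.1
  else fun _ i => False_rect S (notF (ltn_ord i)).

Lemma powgetK n (f : 'I_n -> S) i : powget (powmk f) i = f i.
Proof.
elim: n f i => [f [] //|n IH f i] /=.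
by case: (unliftP ord0 i) => [j|] -> //; rewrite IH.
Qed.

Lemma powgetM n (x y : sgpow n) i : powget (x * y) i = powget x i * powget y i.
Proof.
elim: n x y i => [x y [] //|n IH x y i] /=.
by case: (unliftP ord0 i) => [j|] _ //; rewrite IH.
Qed.

Lemma powget_inj n (x y : sgpow n) : powget x =1 powget y -> x = y.
Proof.
elim: n x y => [[] []//|n IH [x1 x2] [y1 y2] xy]; congr pair.
  by have := xy ord0; rewrite /= unlift_none.
by apply: IH => i; have := xy (lift ord0 i); rewrite /= liftK.
Qed.

Lemma pv_sgpow (V : set finSemigroupType) n : pseudovariety V -> V S -> V (sgpow n).
Proof.
move=> Vpv VS; elim: n => [|n IH] /=; first exact: pv_trivial_sgp.
exact: (pv_prod Vpv VS IH).
Qed.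
End Power.

(** Reading one more letter adds one block, determined by the last [2k+1] letters; these are taken
    from the reversed word, as an automaton stores them. *)
Lemma block_code_rcons (A B : finType) (k : nat) (Phi : block A B k) (w : seq A) a
    (t : k.*2.+1.-tuple A) :
  k.*2 <= size w -> rev (take k.*2.+1 (a :: rev w)) = t ->
  block_code Phi (w ++ [:: a]) = block_code Phi w ++ [:: Phi t].
Proof.
move=> kw tE.
have wE : w = rev (drop k.*2 (rev w)) ++ rev (take k.*2 (rev w)).
  by rewrite -rev_cat cat_take_drop revK.
rewrite {1}wE -catA block_code_cat -?wE; last by rewrite size_rev size_takel ?size_rev.
by rewrite cats1 -rev_cons -[_ :: take _ _]/(take k.*2.+1 (a :: rev w)) tE
  block_code_word.
Qed.

(** * The semigroup of suffixes of length at most [L] *)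

Section SuffixSemigroup.
Variables (A : finType) (L : nat).
Hypothesis L0 : 0 < L.

Definition suffix_class (w : word A) : 'I_#|{: L.-bseq A}| :=
  enum_rank (insub_bseq L (take L (rev w))).

Lemma suffix_classP u v : suffix_class u = suffix_class v <->
  take L (rev u) = take L (rev v).
Proof.
have bs (s : seq A) : val (insub_bseq L (take L s)) = take L s.
  by rewrite insubdK // unfold_in size_take_min geq_minl.
split=> [/enum_rank_inj/(congr1 val)|uv]; first by rewrite !bs.
by rewrite /suffix_class uv.
Qed.

Lemma suffix_classM : word_congruence suffix_class.
Proof.
move=> u u' v v' /suffix_classP eu /suffix_classP ev; apply/suffix_classP.
by rewrite !wvalM !rev_cat; exact: take_cat_congr.
Qed.

Definition suffix_sgp : finSemigroupType := word_quot suffix_classM.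

(** The stored suffix, most recent letter first. *)
Definition last_letters (t : suffix_sgp) : seq A := 
  take L (rev (word_quot_repr (t : word_quot suffix_classM))).

Lemma last_letters_class w : last_letters (word_quot_class suffix_classM w) =
  take L (rev w).
Proof. by apply/suffix_classP/(word_quot_class_eq suffix_classM);
  rewrite word_quot_reprK. Qed.

Lemma last_lettersM (s t : suffix_sgp) :
  last_letters (s * t) = take L (last_letters t ++ last_letters s).
Proof.
rewrite -[s * t]/(word_quot_mul (s : word_quot suffix_classM) t) /word_quot_mul.
rewrite last_letters_class wvalM rev_cat /last_letters.
by apply: take_cat_congr; rewrite take_takel.
Qed.

(** The suffix of an idempotent class has full length [L], so it erases whatever precedes it. *)
Lemma Dpv_suffix_sgp : Dpv suffix_sgp.
Proof.
move=> e; have [w <-] := word_quot_surj e; rewrite /idempotent_elt word_quot_mulE.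
move=> /word_quot_class_eq /suffix_classP ww s; have [v <-] := word_quot_surj s.
rewrite word_quot_mulE; apply/word_quot_class_eq/suffix_classP.
rewrite wvalM rev_cat takel_cat // size_rev.
have aux m : 0 < m -> minn L (m + m) = minn L m -> L <= m by lia.
apply: aux; first by case: (w) => [[]].
by have := congr1 size ww; rewrite !size_take_min !size_rev wvalM size_cat.
Qed.
End SuffixSemigroup.

(** * Recognition of block codes by a semidirect product *)

Section BlockRecognition.
Variables (V : set finSemigroupType) (Vpv : pseudovariety V).
Variable VD : V = pv_star V Dpv.
Variables (A B : finType) (k : nat) (Phi : block A B k).
Variables (S : finSemigroupType) (VS : V S) (F : {multiplicative word B -> S}).

Variables (L : nat) (kL : k.*2.+1 <= L).
Let L0 : 0 < L. Proof. exact: leq_trans kL. Qed.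

Let state := (L.-tuple A * L.-bseq A)%type.
Let n := #|{: state}|.
Let T := suffix_sgp A L.

Let move_state (x : state) (t : T) : state :=
  (x.1, insub_bseq L (take L (last_letters t ++ x.2))).

Let move_stateE x t : (move_state x t).2 = take L (last_letters t ++ x.2) :> seq A.
Proof. by rewrite -[LHS]/(val _) insubdK // unfold_in size_take_min geq_minl. Qed.

Let move_stateM x s t : move_state x (s * t) = move_state (move_state x s) t.
Proof.
apply: injective_projections => //; apply: val_inj.
change (bseqval (move_state x (s * t)).2 = bseqval (move_state (move_state x s) t).2).
rewrite !move_stateE last_lettersM.
have tt s1 : take L (take L s1) = take L s1 by rewrite take_takel.
have idl (s1 : seq A) s2 : take L (take L s1 ++ s2) =
  take L (s1 ++ s2) by exact: take_cat_congr.
have idr (s1 : seq A) s2 : take L (s1 ++ take L s2) =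
  take L (s1 ++ s2) by exact: take_cat_congr.
by rewrite idl idr catA.
Qed.

(** Precomposition turns the right action of [T] on states into a left action on functions from
    states to [S]. *)
Let pow_act (t : T) (f : sgpow S n) : sgpow S n :=
  powmk (fun i => powget f (enum_rank (move_state (enum_val i) t))).

Let pow_actA t t' f : pow_act (t * t') f = pow_act t (pow_act t' f).
Proof. by apply: powget_inj => i; rewrite !powgetK enum_rankK move_stateM. Qed.

Let pow_actM t f g : pow_act t (f * g) = pow_act t f * pow_act t g.
Proof. by apply: powget_inj => i; rewrite powgetM !powgetK powgetM. Qed.

Let action : left_action T (sgpow S n) := LeftAction pow_actA pow_actM.

Variable c : L.-tuple A -> nat -> S.
Hypothesis cP : forall (p : L.-tuple A) (v : word B), wval v = block_code Phi p ->
  F v = sgprod (c p) L.-1.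

(** A state [(p, s)] consists of a guess [p] of the prefix of length [L] of the
    word to be read and of the last letters [s] read so far, in reverse order.
    The factors [c p i] are output during the first [L] steps, and the values of
    the successive blocks afterwards. *)
Let output (x : state) (a : A) : S :=
  if size x.2 < L then c x.1 (size x.2)
  else if insub (rev (take k.*2.+1 (a :: x.2))) is Some t then F (letter (Phi t))
  else c x.1 0.

(** At a given state, the first component of [H w] is the product of the outputs along the run of
    [w] from that state. Started with the correct guess and an empty memory, this run computes the
    image under [F] of the block code of [w], once [w] has at least [L] letters. *)
Lemma block_code_semidirect : exists (U : finSemigroupType) (H : {multiplicative word A
  -> U}),
  V U /\ forall u v : word A, take L u = take L v -> L <= size u -> L <= size v ->
    H u = H v -> forall u' v' : word B, wval u' = block_code Phi u ->
    wval v' = block_code Phi v -> F u' = F v'.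
Proof.
pose f a : sgpow S n := powmk (fun i => output (enum_val i) a).
have [H HP] := word_lift (fun a => (f a, word_quot_class (@suffix_classM A L) (letter
  a)) : semidirect action).
exists (semidirect action), H; split.
  rewrite VD => P Ppv; apply; first exact: pv_sgpow.
  exact: Dpv_suffix_sgp.
have H2 w : (H w).2 = word_quot_class (@suffix_classM A L) w.
  elim/word_rcons_ind: w => [a|w a IH]; first by rewrite HP.
  by rewrite gmulfM /= IH HP -word_quot_mulE.
(* The first component read at the initial state: guess [p], no letter read. *)
pose val0 w (p : L.-tuple A) := powget (H w).1 (enum_rank (p, [bseq])).
have val0_rcons (w : word A) a p : val0 (w * letter a) p = val0 w p * output (p,
  insub_bseq L (take L (rev w))) a.
  rewrite /val0 gmulfM /= powgetM HP /=; congr (_ * _).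
  rewrite powgetK enum_rankK powgetK enum_rankK; congr output; congr pair.
  by rewrite H2 last_letters_class /= cats0 take_takel.
(* For the first [L] letters the outputs are [c p 0], [c p 1] and so on, whatever the letters are
   and whether or not the guess is right. *)
have val0_short (w : word A) (p : L.-tuple A) : size w <= L ->
  val0 w p = sgprod (c p) (size w).-1.
  elim/word_rcons_ind: w => [a|w a IH] wL.
    by rewrite /val0 HP /= powgetK enum_rankK /output /= L0.
  have w1 : (0 < size w)%N by case: (w) => [[]].
  have wa : size (w * letter a) = (size w).+1 by rewrite wvalM size_cat addn1.
  have wL' : size w < L by rewrite -wa.
  have sz : size (insub_bseq L (take L (rev w))) = size w.
    rewrite -[LHS]/(size (val (insub_bseq L (take L (rev w))))).
    rewrite insubdK; first by rewrite take_oversize ?size_rev // ltnW.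
    by rewrite unfold_in size_take_min geq_minl.
  rewrite val0_rcons IH ?(ltnW wL') // wa /output sz wL' /=.
  by case: (size w) w1.
(* With the right guess, the product after [L] letters is the value of the code of [p] by [cP]; each
   further letter multiplies it by the value of one new block. *)
have val0_long (w : word A) (p : L.-tuple A) (v : word B) : L <= size w ->
  take L w = p -> wval v = block_code Phi w ->
    val0 w p = F v.
  elim/word_rcons_ind: w v => [a|w a IH] v Lw wp vE.
    rewrite val0_short // (_ : size (letter a) = L); last first.
      by apply/eqP; rewrite eqn_leq Lw andbT.
    by rewrite (@cP p v) // vE -wp take_oversize.
  have wa : size (w * letter a) = (size w).+1 by rewrite wvalM size_cat addn1.
  move: Lw; rewrite leq_eqVlt => /orP[/eqP Lw|].
    rewrite val0_short -?Lw // (@cP p v) // vE -wp take_oversize //.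
    by rewrite Lw.
  rewrite wa ltnS => Lw.
  have s1 : size (rev (take k.*2.+1 (a :: rev w))) == k.*2.+1.
    by rewrite size_rev size_takel //= size_rev ltnS; apply: leq_trans Lw; exact: ltnW.
  have bw : block_code Phi (w ++ [:: a]) = block_code Phi w ++ [:: Phi (Tuple s1)].
    apply: block_code_rcons => //; apply: leq_trans Lw; exact: ltnW.
  have v'P : ~~ nilp (block_code Phi w).
    by rewrite /nilp size_block_code -lt0n subn_gt0; apply: leq_trans Lw.
  have -> : v = Word v'P * letter (Phi (Tuple s1)) by apply: val_inj; rewrite /= vE bw.
  have wp' : take L w = p by rewrite -wp wvalM takel_cat.
  rewrite val0_rcons (IH (Word v'P)) // gmulfM /output.
  have -> : bseqval (insub_bseq L (take L (rev w))) = take L (rev w).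
    by rewrite -[LHS]/(val _) insubdK // unfold_in size_take_min geq_minl.
  rewrite size_takel ?size_rev // ltnn; congr (_ * _).
  have -> : rev (take k.*2.+1 (a :: take L (rev w))) = val (Tuple s1).
    by rewrite /= take_takel //; exact: ltnW.
  by rewrite valK.
move=> u v uv Lu Lv Huv u' v' u'E v'E.
pose p : L.-tuple A := Tuple (introT eqP (size_takel Lu)).
by rewrite -(val0_long u p u') // -(val0_long v p v') // /val0 Huv.
Qed.
End BlockRecognition.

Lemma recognized_block_code (V : set finSemigroupType) (A B : finType) (k : nat)
    (Phi : block A B k) (r : vquotient V B) :
  pseudovariety V -> LSl `<=` V -> V = pv_star V Dpv ->
  recognized V (fun w => pr r (of_seq V (block_code Phi w))).
Proof.
move=> Vpv LSlV VD; have [m mP] := factorizable_incr r.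
(* The code of a word of length [L] has [m.+1] letters, so its value is a product of [m.+1]
   elements; by the choice of [m] it is also a product of exactly [L] elements. *)
pose L := (m + k.*2.+1)%N; have kL : k.*2.+1 <= L by exact: leq_addl.
have /choice[c cP] (p : L.-tuple A) : exists c : nat -> r, forall v : word B,
    wval v = block_code Phi p -> vq_map r v = sgprod c L.-1.
  have bp : ~~ nilp (block_code Phi p).
    by rewrite /nilp size_block_code size_tuple -lt0n subn_gt0.
  have := factorizable_word (vq_map r) (Word bp).
  rewrite [size _]size_block_code size_tuple => fp.
  have [||d dP] := mP _ L.-1 _ _ _ fp; [rewrite /L; lia..|].
  by exists d => v vE; rewrite (_ : v = Word bp) //; exact: val_inj.
have [U [H [VU HP]]] := block_code_semidirect Vpv VD (vq_mem r) kL cP.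
(* The profile of order [L.+1] identifies words of length at most [L] completely and gives the
   prefix of length [L] of the longer ones. *)
have [q qP] := recognized_pair Vpv (recognized_morphism Vpv H VU)
  (recognized_profile LSlV A L.+1).
exists q => u v /qP e; have Huv := congr1 fst e;
  have uv := (profile_eqP _ _ _).1 (congr1 snd e).
move: Huv => /= {e} Huv.
have [uL|Lu] := ltnP (size u) L.+1; first by rewrite (locally_eq_small uv).
have [vL|Lv] := ltnP (size v) L.+1; first by rewrite (locally_eq_small (locally_eq_sym
  uv)).
rewrite !pr_of_seq.
have ne w : L < size w -> exists w' : word A, w = w' /\ exists v' : word B,
  wval v' = block_code Phi w.
  move=> Lw; have [w0|[w' ww']] := seq_wordP w; first by rewrite w0 in Lw.
  exists w'; split=> //.
  have bp : ~~ nilp (block_code Phi w).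
    by rewrite /nilp size_block_code -lt0n subn_gt0; apply: leq_trans Lw;
      rewrite ltnS ltnW.
  by exists (Word bp).
have [u1 [eu [u' u'E]]] := ne _ Lu; have [v1 [ev [v' v'E]]] := ne _ Lv.
rewrite -u'E -v'E !valK /=; congr Some.
case: uv => [p _ _]; subst u v; move: Huv; rewrite !valK => -[Huv].
apply: (HP u1 v1) => //; [|exact: ltnW..].
by rewrite -(@take_takel _ L L.+1) // p take_takel.
Qed.

(** An extension exists, so [xget] returns one rather than the default constant map. *)
Lemma block_extP (V : set finSemigroupType) (A B : finType) (k : nat) (Phi : block A B
  k) :
  pseudovariety V -> LSl `<=` V -> V = pv_star V Dpv ->
  extends_block_code Phi (@block_ext V A B k Phi).
Proof.
move=> Vpv LSlV VD; have [|h hP] := @recognized_extension V Vpv A B (fun w =>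
  of_seq V (block_code Phi w)).
  by move=> r; exact: recognized_block_code.
by rewrite /block_ext; case: xgetP => [? -> //|/(_ h)].
Qed.

Lemma withI_mul_comp (S : compactSemigroupType) (T : topologicalType) (f g : T ->
  withI S) :
  continuous f -> continuous g -> continuous (fun x => f x * g x).
Proof.
move=> cf cg x.
apply: (@continuous_comp T (withI S * withI S)%type (withI S) (fun x => (f x,
  g x)) (fun p => p.1 * p.2)).
  exact: continuous_pair.
exact: withI_mul_continuous.
Qed.

Lemma continuous_comp_fun (T U W : topologicalType) (f : T -> U) (g : U -> W) :
  continuous f -> continuous g -> continuous (fun x => g (f x)).
Proof. by move=> cf cg x; apply: continuous_comp; [exact: cf|exact: cg]. Qed.

Lemma continuous_const (T U : topologicalType) (u : U) : continuous (fun _ : T => u).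
Proof. by move=> x; exact: cvg_cst. Qed.

Lemma continuous_id (T : topologicalType) : continuous (fun x : T => x).
Proof. by move=> x; exact: cvg_id. Qed.

(** * Finite factors of pseudowords *)

Section Approximation.
Variables (V : set finSemigroupType) (Vpv : pseudovariety V) (LSlV : LSl `<=` V).
Variable A : finType.
Local Notation M := (withI (freeProV V A)).
Local Notation "[ w ]w" := (of_seq V w : M) (at level 0, format "[ w ]w").
Implicit Types (w t : seq A) (x y : M) (L : nat).

(** The pseudoword [x] is a limit of words with the same local data of order [L] as [w], so these
    data of [x] can be read on [w]. *)
Definition approx L w x := wcl V [set v : seq A | locally_eq L v w] x.

Lemma approx_exists L x : exists w, approx L w x.
Proof.
have [w wx] := recognized_fiber Vpv x (recognized_profile LSlV A L).
exists w; apply: (wcl_min _ _ wx); first exact: closed_closure.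
by move=> v /profile_eqP vw; apply: wcl_sub.
Qed.

Lemma locally_eq_refl L w : locally_eq L w w. Proof. by []. Qed.

Lemma approx_of_seq L w : approx L w [w]w.
Proof. by apply: wcl_sub; exact: locally_eq_refl. Qed.

Arguments approx_of_seq : clear implicits.

Lemma wcl_mul (P Q R : set (seq A)) x y : (forall u v, P u -> Q v -> R (u ++ v)) ->
  wcl V P x -> wcl V Q y -> wcl V R (x * y).
Proof.
move=> PQR Px Qy.
have cR : closed (wcl V R) by exact: closed_closure.
apply: (wcl_min (C := [set x | wcl V R (x * y)]) _ _ Px).
  exact: (closed_comp (fun x _ => @withI_mulr_continuous _ y x) cR).
move=> u Pu; apply: (wcl_min (C := [set y | wcl V R (of_seq V u * y)]) _ _ Qy).
  exact: (closed_comp (fun y _ => @withI_mull_continuous _ (of_seq V u) y) cR).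
by move=> v Qv /=; rewrite -of_seq_cat; apply: wcl_sub; exact: PQR.
Qed.

Lemma approx_mul L u v x y : approx L u x -> approx L v y -> approx L (u ++ v) (x * y).
Proof. by apply: wcl_mul => u' v'; exact: locally_eq_cat. Qed.

Lemma approx_wcl L w x (P : set (seq A)) : approx L w x ->
  (forall v, locally_eq L v w -> P v) -> wcl V P x.
Proof.
move=> wx LP; apply: (wcl_min _ _ wx); first exact: closed_closure.
by move=> v /LP; exact: wcl_sub.
Qed.

Definition has_factor t x := exists a b, x = a * [t]w * b.

Lemma compact_image_closed (T : topologicalType) (f : T -> M) :
  compact [set: T] -> continuous f -> closed (range f).
Proof.
move=> cT cf; apply: compact_closed; first exact: withI_hausdorff.
by apply: continuous_compact => //; exact: continuous_subspaceT.
Qed.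

(** From left to right, the two cofactors are approximated by words. Conversely, the pseudowords
    with factor [t] form a continuous image of a compact space, so a closed set, which contains all
    words with factor [t]. Prefixes and suffixes are treated in the same way below. *)
Lemma has_factorP t x : has_factor t x <-> wcl V [set w | infix t w] x.
Proof.
split=> [[a [b ->]]|].
  have [u ua] := approx_exists (size t) a; have [v vb] := approx_exists (size t) b.
  apply: (approx_wcl (approx_mul (approx_mul ua (approx_of_seq _ t)) vb)).
  by move=> w [_ _ i] /=; rewrite i // -catA infix_infix.
move=> tx; suff [[a b] _ <-] : range (fun p : M * M => p.1 * [t]w * p.2) x by exists a, b.
apply: (wcl_min _ _ tx).
  apply: compact_image_closed; first by rewrite -setXTT; apply: compact_setX;
    exact: withI_compact.
  apply: withI_mul_comp; last by move=> p; exact: cvg_snd.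
  by apply: withI_mul_comp; [move=> p; exact: cvg_fst|exact: continuous_const].
move=> w /infixP [u [v ->]]; exists (of_seq V u, of_seq V v) => //=.
by rewrite !of_seq_cat mulgA.
Qed.

Lemma has_prefixP t x : (exists v, x = [t]w * v) <-> wcl V [set w | prefix t w] x.
Proof.
split=> [[a ->]|].
  have [u ua] := approx_exists (size t) a.
  apply: (approx_wcl (approx_mul (approx_of_seq _ t) ua)) => w wtu /=.
  by rewrite (locally_eq_prefix wtu) // prefix_prefix.
move=> tx; suff [a _ <-] : range (fun y : M => [t]w * y) x by exists a.
apply: (wcl_min _ _ tx).
  by apply: compact_image_closed; [exact: withI_compact|exact: withI_mull_continuous].
by move=> w /prefixP [v ->]; exists (of_seq V v); rewrite // of_seq_cat.
Qed.

Lemma has_suffixP t x : (exists v, x = v * [t]w) <-> wcl V [set w | suffix t w] x.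
Proof.
split=> [[a ->]|].
  have [u ua] := approx_exists (size t) a.
  apply: (approx_wcl (approx_mul ua (approx_of_seq _ t))) => w wut /=.
  by rewrite (locally_eq_suffix wut) // suffix_suffix.
move=> tx; suff [a _ <-] : range (fun y : M => y * [t]w) x by exists a.
apply: (wcl_min _ _ tx).
  by apply: compact_image_closed; [exact: withI_compact|exact: withI_mulr_continuous].
by move=> w /suffixP [v ->]; exists (of_seq V v); rewrite // of_seq_cat.
Qed.

Lemma approx_infix L w x t : approx L w x -> size t <= L -> infix t w <-> has_factor t x.
Proof.
move=> wx tL; split=> [tw|/has_factorP tx].
  by apply/has_factorP; apply: (approx_wcl wx) => v [_ _ i] /=; rewrite i.
have [v /= tv [_ _ vw]] := recognized_wcl (recognized_infix LSlV t) tx wx.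
by rewrite -vw.
Qed.

Lemma prefix_unique t t' x v v' : size t = size t' -> x = [t]w * v -> x = [t']w * v' ->
  t = t'.
Proof.
move=> tt' xv xv'.
have Px : wcl V [set w | prefix t w] x by apply/has_prefixP; exists v.
have Px' : wcl V [set w | prefix t' w] x by apply/has_prefixP; exists v'.
have [w /=] := recognized_wcl (recognized_prefix LSlV t) Px Px'.
by rewrite !prefixE tt' => /eqP <- /eqP.
Qed.

Lemma suffix_unique t t' x v v' : size t = size t' -> x = v * [t]w -> x = v' * [t']w ->
  t = t'.
Proof.
move=> tt' xv xv'.
have Px : wcl V [set w | suffix t w] x by apply/has_suffixP; exists v.
have Px' : wcl V [set w | suffix t' w] x by apply/has_suffixP; exists v'.
have [w /=] := recognized_wcl (recognized_suffix LSlV t) Px Px'.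
by rewrite !suffixE tt' => /eqP <- /eqP.
Qed.

Lemma approx_small L w x : approx L w x -> size w < L -> x = [w]w.
Proof.
move=> wx wL; apply: (wcl_min (C := [set of_seq V w]) _ _ wx).
  by apply: compact_closed; [exact: withI_hausdorff|exact: compact_set1].
by move=> v /locally_eq_sym /locally_eq_small <-.
Qed.

(** If [w] were shorter than [L], then [e] would be the word [w] itself, and a word equal to its
    square is empty. *)
Lemma approx_idempotent L w (e : freeProV V A) :
  idempotent_elt e -> approx L w (Some e : M) -> L <= size w.
Proof.
move=> ee we; rewrite leqNgt; apply/negP => wL.
have we' := approx_small we wL.
have : [w ++ w]w = [w]w by rewrite of_seq_cat -we' -[RHS]/(Some e) -[in RHS]ee.
move=> /(of_seq_inj LSlV) /(congr1 size); rewrite size_cat => sw.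
have /size0nil w0 : size w = 0 by lia.
by move: we'; rewrite w0 of_seq_nil.
Qed.

(** Idempotents have approximants of length at least [k], so the set given to [xget] is nonempty and
    its default is not returned. *)
Lemma prefix_ofP k (e : freeProV V A) : idempotent_elt e ->
  size (prefix_of k e) = k /\ exists v : M, Some e = [prefix_of k e]w * v.
Proof.
move=> ee; rewrite /prefix_of; case: xgetP => [w -> //|]/=.
have [w we] := approx_exists k (Some e : M); have kw := approx_idempotent ee we.
move=> /(_ (take k w)) []; split; first by rewrite size_takel.
apply/has_prefixP; apply: (approx_wcl we) => v [vw _ _] /=.
by rewrite -vw prefix_take.
Qed.

Lemma suffix_ofP k (e : freeProV V A) : idempotent_elt e ->
  size (suffix_of k e) = k /\ exists v : M, Some e = v * [suffix_of k e]w.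
Proof.
move=> ee; rewrite /suffix_of; case: xgetP => [w -> //|]/=.
have [w we] := approx_exists k (Some e : M); have kw := approx_idempotent ee we.
move=> /(_ (rev (take k (rev w)))) []; split; first by rewrite size_rev size_takel
  ?size_rev.
apply/has_suffixP; apply: (approx_wcl we) => v [_ vw _] /=.
by rewrite -vw -prefix_rev revK prefix_take.
Qed.

Lemma size_prefix_of k (e : freeProV V A) : idempotent_elt e -> size (prefix_of k e) = k.
Proof. by move=> /(@prefix_ofP k) []. Qed.

Lemma size_suffix_of k (e : freeProV V A) : idempotent_elt e -> size (suffix_of k e) = k.
Proof. by move=> /(@suffix_ofP k) []. Qed.

Lemma prefix_ofE k (e : freeProV V A) t (v : M) : idempotent_elt e ->
  size t = k -> Some e = [t]w * v -> prefix_of k e = t.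
Proof.
move=> ee tk ev; have [sk [v' ev']] := prefix_ofP k ee.
by apply: (prefix_unique _ ev' ev); rewrite sk.
Qed.

Lemma suffix_ofE k (e : freeProV V A) t (v : M) : idempotent_elt e ->
  size t = k -> Some e = v * [t]w -> suffix_of k e = t.
Proof.
move=> ee tk ev; have [sk [v' ev']] := suffix_ofP k ee.
by apply: (suffix_unique _ ev' ev); rewrite sk.
Qed.

(** The pseudowords with a given prefix form the closure of a recognized language, which is open. *)
Lemma prefix_of_locally_constant k (T : topologicalType) (e : T -> freeProV V A) (x : T) :
  continuous e -> (forall z, idempotent_elt (e z)) ->
  nbhs x [set z | prefix_of k (e z) = prefix_of k (e x)].
Proof.
move=> ce ee; have [sk ev] := prefix_ofP k (ee x).
have /continuousP cS := continuous_comp_fun ce (@Some_continuous _).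
apply: filterS (open_nbhs_nbhs (conj (cS _ (wcl_open Vpv (recognized_prefix LSlV
  (prefix_of k (e x))))) _)).
  by move=> y /= /has_prefixP [v yv]; apply: prefix_ofE yv.
exact/has_prefixP.
Qed.

Lemma suffix_of_locally_constant k (T : topologicalType) (e : T -> freeProV V A) (x : T) :
  continuous e -> (forall z, idempotent_elt (e z)) ->
  nbhs x [set z | suffix_of k (e z) = suffix_of k (e x)].
Proof.
move=> ce ee; have [sk ev] := suffix_ofP k (ee x).
have /continuousP cS := continuous_comp_fun ce (@Some_continuous _).
apply: filterS (open_nbhs_nbhs (conj (cS _ (wcl_open Vpv (recognized_suffix LSlV
  (suffix_of k (e x))))) _)).
  by move=> y /= /has_suffixP [v yv]; apply: suffix_ofE yv.
exact/has_suffixP.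
Qed.
End Approximation.
Arguments approx_of_seq : clear implicits.

(** * Block codes on the Karoubi envelope *)

Section BlockExt.
Variables (V : set finSemigroupType) (Vpv : pseudovariety V).
Variables (LSlV : LSl `<=` V) (VD : V = pv_star V Dpv).

Lemma dense_eq (A : finType) (T : topologicalType) (f g : withI (freeProV V A) -> T) :
  hausdorff_space T -> continuous f -> continuous g ->
  (forall w, f (of_seq V w) = g (of_seq V w)) -> forall x, f x = g x.
Proof.
by move=> hT cf cg fg; apply: (@dense_ind V A Vpv [set x | f x = g x]) => //;
  exact: closed_eqfun.
Qed.

Section OneBlock.
Variables (A B : finType) (k : nat) (Phi : block A B k).
Local Notation MA := (withI (freeProV V A)).
Local Notation MB := (withI (freeProV V B)).
Local Notation h := (@block_ext V A B k Phi).
Implicit Types (x y : MA) (e f g u v : freeProV V A).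

Lemma block_ext_continuous : continuous h.
Proof. by have [] := block_extP Phi Vpv LSlV VD. Qed.

Lemma block_ext_seq (w : seq A) : h (of_seq V w) = of_seq V (block_code Phi w).
Proof. by have [_] := block_extP Phi Vpv LSlV VD. Qed.

(** [block_code_cat] extended by density, first in [x] and then in [y]. *)
Lemma block_ext_cat x y (p : seq A) : size p = k.*2 ->
  h (x * of_seq V p * y) = h (x * of_seq V p) * h (of_seq V p * y).
Proof.
move=> sp; have ch := block_ext_continuous.
have cl z := @withI_mull_continuous _ (z : MA);
  have cr z := @withI_mulr_continuous _ (z : MA).
pose f1 y x := h (x * of_seq V p * y); pose f2 y x :=
  h (x * of_seq V p) * h (of_seq V p * y).
apply: (@dense_eq A _ (f1 y) (f2 y)) => [||| u]; first exact: withI_hausdorff.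
- apply: (@continuous_comp_fun MA MA MB (fun x => x * of_seq V p * y) h) => //.
  exact: (@continuous_comp_fun MA MA MA (fun x => x * of_seq V p) (fun z => z * y)).
- apply: withI_mul_comp; last exact: continuous_const.
  exact: (continuous_comp_fun (cr _) ch).
apply: (@dense_eq A _ (f1 ^~ (of_seq V u)) (f2 ^~ (of_seq V u))) => [||| v];
  first exact: withI_hausdorff.
- exact: (continuous_comp_fun (cl _) ch).
- apply: withI_mul_comp; first exact: continuous_const.
  exact: (continuous_comp_fun (cl _) ch).
by rewrite /f1 /f2 -!of_seq_cat !block_ext_seq -of_seq_cat -catA block_code_cat.
Qed.

Lemma block_ext_catr x (w : seq A) : k.*2 <= size w ->
  h (x * of_seq V w) = h (x * of_seq V (take k.*2 w)) * of_seq V (block_code Phi w).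
Proof.
move=> kw; rewrite -{1}(cat_take_drop k.*2 w) of_seq_cat mulgA.
by rewrite block_ext_cat ?size_takel // -of_seq_cat cat_take_drop block_ext_seq.
Qed.

Lemma block_ext_catl y (w : seq A) : k.*2 <= size w ->
  h (of_seq V w * y) =
  of_seq V (block_code Phi w) * h (of_seq V (drop (size w - k.*2) w) * y).
Proof.
move=> kw; rewrite -{1}(cat_take_drop (size w - k.*2) w) of_seq_cat.
by rewrite block_ext_cat ?size_drop ?subKn // -of_seq_cat cat_take_drop block_ext_seq.
Qed.

Lemma closed_not_None : closed [set z : MB | z <> None].
Proof.
rewrite (_ : mkset _ = ~` [set z : MB | (z == None) = true]).
  exact: open_closedC (@open_None _ true).
by apply/seteqP; split=> z /= zN => [/eqP|] //; move=> zE; apply: zN; rewrite zE eqxx.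
Qed.

(** On words the output has at least one letter, and differing from the isolated identity is a
    closed condition. *)
Lemma block_ext_not_None x y (p : seq A) : k.*2 < size p ->
  h (x * of_seq V p * y) <> None.
Proof.
move=> sp; have ch := block_ext_continuous.
have cl z := @withI_mull_continuous _ (z : MA);
  have cr z := @withI_mulr_continuous _ (z : MA).
pose f1 y x := h (x * of_seq V p * y); have cN := closed_not_None.
apply: (dense_ind Vpv (C := [set x | f1 y x <> None])) => [|u /=].
  apply: (closed_comp (f := f1 y)) cN => z _; move: z.
  apply: (@continuous_comp_fun MA MA MB (fun x => x * of_seq V p * y) h) => //.
  exact: (@continuous_comp_fun MA MA MA (fun x => x * of_seq V p) (fun z => z * y)).
apply: (dense_ind Vpv (C := [set y | f1 y (of_seq V u) <> None])) => [|v /=].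
  apply: (closed_comp (f := f1 ^~ (of_seq V u))) cN => z _; move: z.
  exact: (continuous_comp_fun (cl _) ch).
rewrite /f1 -!of_seq_cat block_ext_seq -(of_seq_nil V B) =>
  /(of_seq_inj LSlV) /(congr1 size).
by rewrite size_block_code !size_cat /=; lia.
Qed.

Section Idempotents.
Variables (e f g : freeProV V A).
Hypotheses (ee : idempotent_elt e) (ff : idempotent_elt f).

(** Since [u * f = u] and [f * v = v], the pseudoword [u] ends with the suffix of [f] of length [k]
    and [v] starts with its prefix of length [k]. The two arguments thus overlap in the word [p] of
    length [2k] made of this suffix and this prefix, where [block_ext_cat] applies. *)
Lemma PhiK_mid_mul u v : u * f = u -> f * v = v ->
  PhiK_mid Phi e u f * PhiK_mid Phi f v g = PhiK_mid Phi e (u * v) g.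
Proof.
move=> uf fv; rewrite /PhiK_mid.
have [sp [f1 fE1]] := prefix_ofP Vpv LSlV k ff;
  have [ss [f2 fE2]] := suffix_ofP Vpv LSlV k ff.
have uE : Some u = (Some u : MA) * f2 * of_seq V (suffix_of k f) :> MA.
  by rewrite -mulgA -fE2 -[LHS]/(Some u) -[in LHS]uf.
have vE : Some v = of_seq V (prefix_of k f) * (f1 * (Some v : MA)) :> MA.
  by rewrite mulgA -fE1 -[LHS]/(Some v) -[in LHS]fv.
rewrite -[Some (u * v)]/((Some u : MA) * Some v) uE vE.
rewrite -!mulgA !(mulgA (of_seq V (suffix_of k f))) -of_seq_cat.
set p := suffix_of k f ++ prefix_of k f.
have sp2 : size p = k.*2 by rewrite size_cat sp ss addnn.
have := block_ext_cat (of_seq V (suffix_of k e) * ((Some u : MA) * f2)) (f1 * ((Some v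
  : MA) * of_seq V (prefix_of k g))) sp2.
by rewrite -!mulgA => <-.
Qed.

(** As [e * u = u], the argument contains the prefix of [e] of length [2k+1], which is a whole
    window. *)
Lemma PhiK_mid_Some u : e * u = u -> exists z : freeProV V B, PhiK_mid Phi e u f = Some z.
Proof.
move=> eu; case E: (PhiK_mid Phi e u f) => [z|]; first by exists z.
have [sp [e1 eE]] := prefix_ofP Vpv LSlV k.*2.+1 ee; case: (@block_ext_not_None
  (of_seq V (suffix_of k e)) (e1 * (Some u : MA) * of_seq V (prefix_of k f)) (prefix_of
    k.*2.+1 e)); first by rewrite sp.
rewrite -E /PhiK_mid; congr h; rewrite -!mulgA; congr (_ * _).
by rewrite !mulgA -eE -[(Some e : MA) * (Some u : MA)]/(Some (e * u) : MA) eu.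
Qed.
End Idempotents.

(** Near [t] the suffix of [e] and the prefix of [f] are constant, so the map coincides there with
    [F], in which both words are frozen. *)
Lemma PhiK_mid_continuous (T : topologicalType) (e u f : T -> freeProV V A) :
  continuous e -> continuous u -> continuous f ->
  (forall t, idempotent_elt (e t)) -> (forall t, idempotent_elt (f t)) ->
  continuous (fun t => PhiK_mid Phi (e t) (u t) (f t)).
Proof.
move=> ce cu cf ee ff t U /= nU.
pose F t' := h (of_seq V (suffix_of k (e t)) * (Some (u t') : MA) * of_seq V (prefix_of
  k (f t))).
have cF : continuous F.
  apply: (continuous_comp_fun _ block_ext_continuous).
  apply: withI_mul_comp; last exact: continuous_const.
  apply: withI_mul_comp; first exact: continuous_const.
  exact: (continuous_comp_fun cu (@Some_continuous _)).
have n1 : nbhs t (F @^-1` U) := cF t U nU.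
have n2 := suffix_of_locally_constant Vpv LSlV k t ce ee.
have n3 := prefix_of_locally_constant Vpv LSlV k t cf ff.
change (nbhs t [set t' | U (PhiK_mid Phi (e t') (u t') (f t'))]).
apply: filterS (filterI n1 (filterI n2 n3)) => t' [/= Ut' [se pf]].
by rewrite /PhiK_mid se pf.
Qed.
End OneBlock.

Lemma block_code_take (A B : finType) (k : nat) (Phi : block A B k) n (w : seq A) :
  n + k.*2 <= size w -> take n (block_code Phi w) = block_code Phi (take (n + k.*2) w).
Proof.
move=> nw; rewrite -{1}(cat_take_drop (n + k.*2) w) takeD -catA block_code_cat.
  by apply: take_size_cat; rewrite size_block_code -takeD size_takel // addnK.
by rewrite size_takel // size_drop; lia.
Qed.

(** * Composition of block codes *)

Section BlockComp.
Variables (A B C : finType) (k l : nat) (Psi : block B C l) (Phi : block A B k).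

Fact block_comp_subproof (t : (k + l).*2.+1.-tuple A) : size (block_code Phi t) ==
  l.*2.+1.
Proof. by rewrite size_block_code size_tuple; apply/eqP; lia. Qed.

Definition block_comp : block A C (k + l) := fun t => Psi (Tuple (block_comp_subproof t)).

Lemma block_comp_code w : block_code block_comp w = block_code Psi (block_code Phi w).
Proof.
elim: w => // a w IH; have [aw|aw] := leqP (size (a :: w)) (k + l).*2.
  rewrite (block_code_small _ aw) (@block_code_small _ _ _ Psi) //.
  by rewrite size_block_code leq_subLR -doubleD.
have [t tE] := take_tupleP aw.
have kaw : k.*2 < size (a :: w) by apply: leq_ltn_trans aw; rewrite leq_double leq_addr.
have [s sE] := take_tupleP kaw.
rewrite (block_code_cons _ tE) IH (block_code_cons _ sE); apply: esym;
  apply: block_code_cons.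
rewrite -(block_code_cons _ sE) block_code_take addSn (addnC l.*2) -doubleD //.
by rewrite tE.
Qed.
End BlockComp.

Lemma block_ext_comp (A B C : finType) (k l : nat) (Psi : block B C l) (Phi : block A B k)
    (x : withI (freeProV V A)) :
  block_ext (block_comp Psi Phi) x = block_ext Psi (block_ext Phi x) :> withI (freeProV
    V C).
Proof.
apply: (dense_eq (f := fun x => block_ext _ x) (g :=
  fun x => block_ext Psi (block_ext Phi x))).
- exact: withI_hausdorff.
- exact: block_ext_continuous.
- exact: (continuous_comp_fun (@block_ext_continuous _ _ _ _) (@block_ext_continuous _
  _ _ _)).
- by move=> w; rewrite !block_ext_seq block_comp_code.
Qed.

(** Write the suffix of [e] of length [k + l] as [a ++ t] and the prefix of [f] of length [k + l] as
    [i ++ b], with [a] and [b] of length [l]. The code by [Phi] of [a t u i b] splits into the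
    suffix of [e'] of length [l], then [u'], then the prefix of [f'] of length [l]; it remains to
    apply the extension of [Psi]. *)
Lemma PhiK_mid_comp (A B C : finType) (k l : nat) (Psi : block B C l) (Phi : block A B k)
    (e u f : freeProV V A) (e' u' f' : freeProV V B) :
  idempotent_elt e -> idempotent_elt f -> idempotent_elt e' -> idempotent_elt f' ->
  e * u = u -> u * f = u ->
  PhiK_ob Phi e = Some e' -> PhiK_mid Phi e u f = Some u' -> PhiK_ob Phi f = Some f' ->
  PhiK_mid (block_comp Psi Phi) e u f = PhiK_mid Psi e' u' f'.
Proof.
move=> ee ff ee' ff' eu uf e'E u'E f'E.
have [se [e1 eE]] := suffix_ofP Vpv LSlV (k + l) ee.
have [sf [f1 fE]] := prefix_ofP Vpv LSlV (k + l) ff.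
have [pe [e2 eE2]] := prefix_ofP Vpv LSlV k ee.
have [pf [f2 fE2]] := suffix_ofP Vpv LSlV k ff.
set a := take l (suffix_of (k + l) e); set t := drop l (suffix_of (k + l) e).
set i := take k (prefix_of (k + l) f); set b := drop k (prefix_of (k + l) f).
have at_ : suffix_of (k + l) e = a ++ t by rewrite cat_take_drop.
have ib : prefix_of (k + l) f = i ++ b by rewrite cat_take_drop.
have sa : size a = l by rewrite size_takel // se leq_addl.
have sb : size b = l by rewrite size_drop sf addKn.
have st : size t = k by rewrite size_drop se addnK.
have si : size i = k by rewrite size_takel // sf leq_addr.
have tE : suffix_of k e = t.
  by apply: (suffix_ofE Vpv LSlV (v := e1 * of_seq V a)) => //;
    rewrite -mulgA -of_seq_cat -at_.
have iE : prefix_of k f = i.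
  by apply: (prefix_ofE Vpv LSlV (v := of_seq V b * f1)) => //;
    rewrite mulgA -of_seq_cat -ib.
set i' := prefix_of k e in pe eE2; set t' := suffix_of k f in pf fE2.
have sti : size (t ++ i') = k.*2 by rewrite size_cat st pe addnn.
have sti' : size (t' ++ i) = k.*2 by rewrite size_cat pf si addnn.
(* Here [e'] is the image of [t e1 a t i'], which ends with the code of [a ++ t ++ i'], a word of
   length [l]. *)
have suf : suffix_of l e' = block_code Phi (a ++ t ++ i').
  apply: (suffix_ofE Vpv LSlV (v := block_ext Phi (of_seq V t * e1 * of_seq V (take
    k.*2 (a ++ t ++ i'))))) => //.
    by rewrite size_block_code size_cat sa sti addnK.
  rewrite -block_ext_catr; last by rewrite size_cat sti leq_addl.
  rewrite -e'E /PhiK_ob tE eE at_ -/i'; congr block_ext.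
  by rewrite !of_seq_cat !mulgA.
have pre : prefix_of l f' = block_code Phi (t' ++ i ++ b).
  apply: (prefix_ofE Vpv LSlV (v := block_ext Phi (of_seq V (drop (size (t' ++ i ++ b)
    - k.*2) (t' ++ i ++ b)) * (f1 * of_seq V i)))) => //.
    by rewrite size_block_code catA size_cat sb sti' addKn.
  rewrite -block_ext_catl; last by rewrite catA size_cat sti' leq_addr.
  rewrite -f'E /PhiK_ob iE fE ib -/t'; congr block_ext.
  by rewrite !of_seq_cat !mulgA.
rewrite [LHS]block_ext_comp /PhiK_mid; congr block_ext; rewrite suf pre at_ ib.
have uE1 : Some u = of_seq V i' * (e2 * (Some u : withI (freeProV V A))).
  by rewrite mulgA -eE2 -[LHS]/(Some u) -[in LHS]eu.
have uE2 : Some u = (Some u : withI (freeProV V A)) * f2 * of_seq V t'.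
  by rewrite -mulgA -fE2 -[LHS]/(Some u) -[in LHS]uf.
(* The cuts are made at [t ++ i'], where [u] starts with [i'], and at [t' ++ i], where [u] ends with
   [t']. *)
have H1 := block_ext_cat Phi (of_seq V a) (e2 * (Some u : withI (freeProV V A)) *
  of_seq V (i ++ b)) sti.
have H2 := block_ext_cat Phi (of_seq V t * ((Some u : withI (freeProV V A)) * f2))
  (of_seq V b) sti'.
transitivity (block_ext Phi (of_seq V a * of_seq V (t ++ i') *
    (e2 * (Some u : withI (freeProV V A)) * of_seq V (i ++ b)))).
  by rewrite [in LHS]uE1; congr block_ext; rewrite !of_seq_cat !mulgA.
rewrite H1 -of_seq_cat block_ext_seq -[RHS]mulgA; congr (_ * _).
transitivity (block_ext Phi (of_seq V t * ((Some u : withI (freeProV V A)) * f2) *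
    of_seq V (t' ++ i) * of_seq V b)).
  transitivity (block_ext Phi (of_seq V t * (Some u : withI (freeProV V A)) * of_seq V
    (i ++ b))).
    by congr block_ext; rewrite [in RHS]uE1 of_seq_cat -!mulgA.
  by congr block_ext; rewrite [in LHS]uE2 !of_seq_cat -!mulgA.
rewrite H2 -of_seq_cat block_ext_seq -catA; congr (_ * _).
rewrite -u'E /PhiK_mid tE iE [in RHS]uE2; congr block_ext.
by rewrite !of_seq_cat !mulgA.
Qed.
End BlockExt.

(** * Block maps of subshift morphisms *)

Section Windows.
Variable A : Type.
Implicit Types (x : int -> A) (i : int) (n m : nat).

Definition window x i n : seq A := [seq x (i + j%:Z)%R | j <- iota 0 n].

Lemma size_window x i n : size (window x i n) = n.
Proof. by rewrite size_map size_iota. Qed.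

Lemma take_window x i m n : m <= n -> take m (window x i n) = window x i m.
Proof. by move=> mn; rewrite -map_take take_iota (minn_idPl mn). Qed.

Lemma drop_window x i m n : drop m (window x i n) = window x (i + m%:Z)%R (n - m).
Proof.
rewrite -map_drop drop_iota add0n -[X in iota X]addn0 iotaDl -map_comp.
by apply: eq_map => j /=; rewrite PoszD addrA.
Qed.

Lemma windowS x i n : window x i n.+1 = x i :: window x (i + 1)%R n.
Proof.
rewrite /window /= addr0 -[X in iota X]addn0 iotaDl -map_comp; congr cons.
by apply: eq_map => j /=; rewrite PoszD addrA.
Qed.

Lemma tuple_window x i n : [tuple x (i + j%:Z)%R | j < n] = window x i n :> seq A.
Proof.
rewrite /= /window -val_enum_ord -map_comp.
by apply: eq_map.
Qed.
End Windows.

Section BlockWords.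
Variables (A B : finType) (k : nat) (Phi : block A B k).

Lemma drop_block_code i (w : seq A) : drop i (block_code Phi w) =
  block_code Phi (drop i w).
Proof.
elim: w i => // a w IH [|i]; first by rewrite !drop0.
rewrite [in RHS]/=; have [aw|aw] := leqP (size (a :: w)) k.*2.
  rewrite !block_code_small //; first by rewrite size_drop; move: aw => /=; lia.
have [t tE] := take_tupleP aw.
by rewrite (block_code_cons _ tE) /= IH.
Qed.

(** Removing letters at either end of a word removes as many letters of its code, as long as the
    code has some left; a nonempty [t] is thus the code of a factor with [2k] more letters. *)
Lemma infix_block_code t (w : seq A) : infix t (block_code Phi w) ->
  exists w', [/\ infix w' w, size w' <= size t + k.*2 & block_code Phi w' = t].
Proof.
case: t => [|b t] tw; first by exists [::]; rewrite infix0s.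
have /infixP [u [v uv]] := tw; pose w2 := drop (size u) w.
have e : block_code Phi w2 = (b :: t) ++ v by rewrite -drop_block_code uv drop_size_cat.
have sw : size (b :: t) + k.*2 <= size w2.
  by have := congr1 size e; rewrite size_block_code size_cat /=; lia.
exists (take (size (b :: t) + k.*2) w2); split.
- exact: infix_trans (infix_take _ _) (infix_drop _ _).
- by rewrite size_takel.
- by rewrite -block_code_take // e take_size_cat.
Qed.
End BlockWords.

Section Language.
Variable X : subshift.
Implicit Types w t : seq (alphabet X).

(** The language of [X] with the empty word added, stated on sequences. *)
Definition occurs w := exists2 x, pts X x & exists i, w = window x i (size w).

Lemma occurs_nil : occurs [::].
Proof. by have [x Xx] := pts_nonempty X; exists x => //; exists 0%R. Qed.
End Language.

Arguments occurs X w : clear implicits.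

Section CentralBlockMaps.
Variables (X Y : subshift) (phi : subshift_hom X Y).

Lemma central_window k (Phi : block (alphabet X) (alphabet Y) k) (x : pts X) i
    (t : k.*2.+1.-tuple (alphabet X)) : central_block_map phi Phi ->
  t = window (\val x) i k.*2.+1 :> seq _ -> Phi t = \val (phi x) (i + k%:Z)%R.
Proof.
move=> -> tE; congr Phi; apply: val_inj; rewrite /= tE -tuple_window /=.
by apply: eq_map => j; rewrite addrK.
Qed.

Lemma block_code_window k (Phi : block (alphabet X) (alphabet Y) k) (x : pts X) i n :
  central_block_map phi Phi ->
  block_code Phi (window (\val x) i n) = window (\val (phi x)) (i + k%:Z)%R (n - k.*2).
Proof.
move=> cPhi; elim: n i => // n IH i; have [nk|kn] := leqP n.+1 k.*2.
  rewrite block_code_small ?size_window //.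
  by have /eqP -> : (n.+1 - k.*2 == 0)%N by rewrite subn_eq0.
have tE : take k.*2.+1 (window (\val x) i n.+1) =
    [tuple \val x (i + k%:Z - k%:Z + j%:Z)%R | j < k.*2.+1].
  by rewrite take_window // tuple_window addrK.
rewrite subSn // windowS; rewrite windowS in tE.
rewrite (block_code_cons _ tE) -cPhi IH windowS; congr (_ :: window _ _ _).
by rewrite addrAC.
Qed.

Lemma occurs_block_code k (Phi : block (alphabet X) (alphabet Y) k) w :
  central_block_map phi Phi -> occurs X w -> occurs Y (block_code Phi w).
Proof.
move=> cPhi [x Xx [i wE]]; exists (\val (phi (Defs.in_set Xx))); first exact: set_valP.
exists (i + k%:Z)%R; rewrite size_block_code {1}wE.
exact: (block_code_window (Defs.in_set Xx) i (size w) cPhi).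
Qed.

(** On a window occurring in [X] both block maps compute the same coordinate of [phi]; the larger
    wing reads [d] extra letters on each side, which are trimmed for [Phi]. *)
Lemma block_code_trim k d (Phi : block (alphabet X) (alphabet Y) k)
    (Psi : block (alphabet X) (alphabet Y) (k + d)) w :
  central_block_map phi Phi -> central_block_map phi Psi ->
  (forall t, infix t w -> size t <= (k + d).*2.+1 -> occurs X t) ->
  block_code Psi w = block_code Phi (drop d (take (size w - d) w)).
Proof.
move=> cPhi cPsi; elim: w => [|a w IH] aw.
  by rewrite !block_code_small // size_drop size_take_min /= minn0 sub0n.
have [sw|sw] := leqP (size (a :: w)) (k + d).*2.
  by rewrite !block_code_small // size_drop size_take_min; lia.
have [s sE] := take_tupleP sw.
have s1 : k.*2 < size (drop d (take (size (a :: w) - d) (a :: w))).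
  by rewrite size_drop size_take_min; lia.
have [t tE] := take_tupleP s1.
have dT : d < size (take (size (a :: w) - d) (a :: w)) by rewrite size_take_min; lia.
have dE : drop d (take (size (a :: w) - d) (a :: w)) =
    nth a (take (size (a :: w) - d) (a :: w)) d :: drop d (take (size w - d) w).
  rewrite (drop_nth a) //; congr cons.
  by rewrite [size _]/= subSn //; move: sw => /=; lia.
have swi : infix s (a :: w) by rewrite -sE; exact: infix_take.
(* The point [x] shows [s] at position [i] and [t] at position [i + d], so [Psi s] and [Phi t] are
   both the coordinate of [phi x] at [i + k + d]. *)
have [|x Xx [i]] := aw s swi; first by rewrite size_tuple.
rewrite size_tuple => sx.
have tx : t = window x (i + d%:Z)%R k.*2.+1 :> seq _.
  rewrite -tE take_drop take_takel; last by move: sw => /=; lia.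
  have -> : take (k.*2.+1 + d) (a :: w) = take (k.*2.+1 + d) s.
    by rewrite -sE take_takel //; lia.
  by rewrite sx take_window ?drop_window ?addnK //; lia.
rewrite (block_code_cons _ sE) dE; rewrite dE in tE; rewrite (block_code_cons _ tE) IH;
  last first.
  by move=> u uw su; apply: aw => //; rewrite -cat1s; exact: infix_catl.
congr cons; rewrite (@central_window _ Psi (Defs.in_set Xx) i s) //.
rewrite (@central_window _ Phi (Defs.in_set Xx) (i + d%:Z)%R t) //.
by congr (\val _ _); rewrite PoszD addrAC addrA.
Qed.
End CentralBlockMaps.

Lemma central_block_comp (X Y Z : subshift) (psi : subshift_hom Y Z) (phi :
  subshift_hom X Y)
    k l (Psi : block (alphabet Y) (alphabet Z) l) (Phi : block (alphabet X) (alphabet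
      Y) k) :
  central_block_map psi Psi -> central_block_map phi Phi ->
  central_block_map (@ccomp subshiftCat X Y Z psi phi) (block_comp Psi Phi).
Proof.
move=> cPsi cPhi x i; rewrite /block_comp.
rewrite (central_window (x := phi x) (i := (i - l%:Z)%R) cPsi) /= ?subrK //.
rewrite tuple_window (block_code_window _ _ _ cPhi).
have -> : ((k + l).*2.+1 - k.*2)%N = l.*2.+1 by lia.
by congr window; rewrite PoszD; lia.
Qed.

Definition letter_block (A : finType) : block A A 0 := fun t => thead t.

Lemma central_letter_block (X : subshift) :
  central_block_map (@Defs.cid subshiftCat X) (@letter_block (alphabet X)).
Proof.
by move=> x i; rewrite /letter_block /thead tnth_mktuple /= subr0 addr0.
Qed.

Lemma letter_block_code (A : finType) (w : seq A) : block_code (@letter_block A) w = w.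
Proof.
elim: w => // a w IH; rewrite (@block_code_cons _ _ 0 _ a w [tuple a]) ?IH //=.
by rewrite take0.
Qed.

Lemma coordinate_continuous (X : subshift) i :
  continuous (fun x : pts X => \val x i : discrete_topology (alphabet X)).
Proof.
apply: (@continuous_comp_fun (pts X) (fullshift (alphabet X))
  (discrete_topology (alphabet X)) \val (fun y => y i)); first exact: val_continuous.
exact: (@proj_continuous int (fun=> discrete_topology (alphabet X)) i).
Qed.

Lemma nbhs_coordinate (X : subshift) (x : pts X) i :
  nbhs x [set z : pts X | \val z i = \val x i].
Proof.
apply: (@coordinate_continuous X i x [set \val x i]).
by apply: open_nbhs_nbhs; split=> //; exact: discrete_open.
Qed.

(** * The Curtis-Hedlund-Lyndon theorem *)

Section CurtisHedlundLyndon.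
Variable X : subshift.

Fact pts_compact : compact (pts X).
Proof.
apply: (subclosed_compact (@pts_closed X) _ (@subsetT _ _)).
have := @tychonoff int (fun=> discrete_topology (alphabet X))
  (fun=> setT) (fun=> @finite_compact (discrete_topology (alphabet X)) setT
    (@finite_finset (alphabet X) setT)).
by congr compact; apply/seteqP; split.
Qed.

(** The point [y] is a translate of [x] by an iterate of the shift. For negative [i], preimages
    exist because the shift maps [X] onto itself. The second clause reduces all coordinates of
    [phi x] to coordinate 0. *)
Lemma shift_iter (x : pts X) (i : int) : exists y : pts X,
  (forall j, \val y j = \val x (j + i)%R) /\
  forall (Y : subshift) (phi : subshift_hom X Y) j,
    \val (phi y) j = \val (phi x) (j + i)%R.
Proof.
have sh (z : pts X) : exists y : pts X, (forall j, \val y j = \val z (j + 1)%R) /\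
    forall (Y : subshift) (phi : subshift_hom X Y) j,
      \val (phi y) j = \val (phi z) (j + 1)%R.
  by exists (shift_pts z); split=> // Y phi j; rewrite shom_shift.
have sh' (z : pts X) : exists y : pts X, (forall j, \val y j = \val z (j - 1)%R) /\
    forall (Y : subshift) (phi : subshift_hom X Y) j,
      \val (phi y) j = \val (phi z) (j - 1)%R.
  have := set_valP z; rewrite -{1}(pts_shift X) => -[y Xy yz].
  have zE : z = shift_pts (Defs.in_set Xy) by apply: val_inj; rewrite /= -yz.
  exists (Defs.in_set Xy); split=> [j|Y phi j].
    by rewrite zE /= /shift subrK.
  by rewrite zE shom_shift /= /shift subrK.
have pos n : exists y : pts X, (forall j, \val y j = \val x (j + n%:Z)%R) /\
    forall (Y : subshift) (phi : subshift_hom X Y) j,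
      \val (phi y) j = \val (phi x) (j + n%:Z)%R.
  elim: n => [|n [y [yx yp]]]; first by exists x; split=> [j|Y phi j]; rewrite addr0.
  have [z [zy zp]] := sh y; exists z; split=> [j|Y phi j].
    by rewrite zy yx; congr (\val x _); lia.
  by rewrite zp yp; congr (\val (phi x) _); lia.
have neg n : exists y : pts X, (forall j, \val y j = \val x (j - n%:Z)%R) /\
    forall (Y : subshift) (phi : subshift_hom X Y) j,
      \val (phi y) j = \val (phi x) (j - n%:Z)%R.
  elim: n => [|n [y [yx yp]]]; first by exists x; split=> [j|Y phi j]; rewrite subr0.
  have [z [zy zp]] := sh' y; exists z; split=> [j|Y phi j].
    by rewrite zy yx; congr (\val x _); lia.
  by rewrite zp yp; congr (\val (phi x) _); lia.
by case: (intP i) => [|n|n]; [exact: (pos 0%N)|exact: (pos n.+1)|exact: (neg n.+1)].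
Qed.

(** By compactness, coordinate 0 of the image depends only on a central window of uniform size.
    Otherwise, pairs agreeing on ever larger windows with distinct images at 0 cluster at some
    [(x, y)]; then [x = y], against continuity of [phi]. *)
Lemma central_block_map_exists (Y : subshift) (phi : subshift_hom X Y) :
  exists k (Phi : block (alphabet X) (alphabet Y) k), central_block_map phi Phi.
Proof.
pose agree k (x y : pts X) := window (\val x) (- k%:Z)%R k.*2.+1 =
  window (\val y) (- k%:Z)%R k.*2.+1.
suff [k kP] : exists k, forall x y : pts X, agree k x y ->
  \val (phi x) 0%R = \val (phi y) 0%R.
  (* [b0] is the value of the block map on the windows that no point of [X] realizes. *)
  have [b0 _] : exists b : alphabet Y, True.
    by have [y _] := pts_nonempty Y; exists (y 0%R).
  pose P (t : k.*2.+1.-tuple (alphabet X)) (b : alphabet Y) :=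
    exists x : pts X, window (\val x) (- k%:Z)%R k.*2.+1 = t /\ \val (phi x) 0%R = b.
  exists k, (fun t => xget b0 (P t)) => x i.
  have [y [yx yp]] := shift_iter x i.
  rewrite -[i in LHS]add0r -yp; case: xgetP => [b _ [z [zt <-]]|nP].
    apply: kP; rewrite /agree zt -(tuple_window (\val y)) /=.
    by apply: eq_map => j; rewrite yx; congr (\val x _); lia.
  case: (nP (\val (phi y) 0%R)); exists y; split=> //.
  rewrite -(tuple_window (\val y)) /=.
  by apply: eq_map => j; rewrite yx; congr (\val x _); lia.
apply: contrapT => nk.
pose D k := [set p : pts X * pts X | agree k p.1 p.2 /\ \val (phi p.1) 0%R <> \val (phi
  p.2) 0%R].
have D0 k : D k !=set0.
  apply: contrapT => nD; apply: nk; exists k => x y xy; apply: contrapT => nxy.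
  by apply: nD; exists (x, y).
have agreeP k x y : agree k x y -> forall i : int, (- k%:Z <= i <= k%:Z)%R ->
  \val x i = \val y i.
  move=> xy i ik; have := congr1 (fun s => nth (\val x i) s (absz (i + k%:Z)%R)) xy.
  rewrite !(nth_map 0%N) ?size_iota ?nth_iota; [|lia..].
  by have -> : (- k%:Z + Posz (0 + absz (i + k%:Z)) = i)%R by lia.
have Dle k l : (k <= l)%N -> D l `<=` D k.
  move=> kl [x y] [/= /agreeP xy nxy]; split=> //=.
  by apply/eq_in_map => j; rewrite mem_iota => jk; apply: xy; lia.
have FD : ProperFilter (filter_from setT D).
  apply: filter_from_proper => //; apply: filter_from_filter; first by exists 0%N.
  by move=> k l _ _; exists (maxn k l) => // p Dp; split; apply: Dle Dp;
    rewrite ?leq_maxl ?leq_maxr.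
have cXX : compact [set: pts X * pts X].
  by rewrite -setXTT; apply: compact_setX; apply: set_type_compact; exact: pts_compact.
have [|[x y] [_ clxy]] := cXX _ FD; first exact: filterT.
have cc1 i : nbhs (x, y) [set p : pts X * pts X | \val p.1 i = \val x i /\ \val p.2 i =
  \val y i].
  exists ([set z | \val z i = \val x i], [set z | \val z i = \val y i]) => //=.
  by split; exact: nbhs_coordinate.
have xy : x = y.
  apply: val_inj; apply: functional_extensionality_dep => i.
  have [|[x' y'] [[/agreeP ag _] [/= <- <-]]] := clxy (D (absz i)) _ _ (cc1 i);
    first by exists (absz i).
  by apply: ag; lia.
have cc2 : nbhs (x, y) [set p : pts X * pts X | \val (phi p.1) 0%R =
  \val (phi x) 0%R /\ \val (phi p.2) 0%R = \val (phi y) 0%R].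
  exists ([set z | \val (phi z) 0%R = \val (phi x) 0%R],
    [set z | \val (phi z) 0%R = \val (phi y) 0%R]) => //=.
  have np z := @shom_continuous _ _ phi z _ (nbhs_coordinate (phi z) 0%R).
  by split; exact: np.
have [|[x' y'] [[_ nxy] [/= ex ey]]] := clxy (D 0%N) _ _ cc2; first by exists 0%N.
by apply: nxy; rewrite /= ex ey xy.
Qed.
End CurtisHedlundLyndon.

(** * The mirage and its functor *)

Section Mirage.
Variables (V : set finSemigroupType) (Vpv : pseudovariety V).
Variable LSlV : LSl `<=` V.

(** The mirage condition on the monoid with identity; the empty factor is harmless by
    [occurs_nil]. *)
Definition in_mirage (X : subshift) (x : withI (freeProV V (alphabet X))) : Prop :=
  forall t, has_factor t x -> occurs X t.

Lemma mirageP (X : subshift) (u : freeProV V (alphabet X)) :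
  mirage V X u <-> @in_mirage X (Some u).
Proof.
split=> [uX t [x [y xy]]|uX w [x [y xy]]].
  have [->|[w tw]] := seq_wordP t; first exact: occurs_nil.
  by rewrite tw; apply: uX; exists x, y; rewrite -of_seq_word -tw.
by apply: uX; exists x, y; rewrite of_seq_word.
Qed.

Lemma in_mirage_factor (X : subshift) (a x b : withI (freeProV V (alphabet X))) :
  in_mirage (a * x * b) -> in_mirage x.
Proof.
move=> axb t [c [d xE]]; apply: axb; exists (a * c), (d * b).
by rewrite xE !mulgA.
Qed.

(** Having a given finite factor is an open condition, so excluding all words that do not occur is a
    closed one. *)
Lemma closed_mirage (X : subshift) : closed (mirage V X).
Proof.
rewrite (_ : mirage V X = \bigcap_(t in [set t | ~ occurs X t])
    ~` (Some @^-1` (wcl V [set w | infix t w]))).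
  apply: closed_bigI => t _; apply: open_closedC.
  have /continuousP := @Some_continuous (freeProV V (alphabet X)); apply.
  exact: (wcl_open Vpv (recognized_infix LSlV t)).
apply/seteqP; split=> [u /mirageP uX t nt /= tu|u uX].
  by apply: nt; apply: uX; apply/(has_factorP Vpv LSlV).
apply/mirageP => t /(has_factorP Vpv LSlV) tu; apply: contrapT => nt.
exact: (uX t nt).
Qed.

(** A finite factor of [u e e v] straddling the middle lies in [s p], where [s]
    and [p] are the suffix and the prefix of [e] of the length of this factor;
    and [s p] is a factor of [e e = e], hence of [u]. *)
Lemma mirage_mul (X : subshift) (u e v : freeProV V (alphabet X)) : idempotent_elt e ->
  u * e = u -> e * v = v -> mirage V X u -> mirage V X v -> mirage V X (u * v).
Proof.
move=> ee ue ev /mirageP uX /mirageP vX; apply/mirageP => t.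
pose M := withI (freeProV V (alphabet X)); pose n := size t.
have [ss [e1 eE1]] := suffix_ofP Vpv LSlV n ee;
  have [sp [e2 eE2]] := prefix_ofP Vpv LSlV n ee.
set s := suffix_of n e in ss eE1; set p := prefix_of n e in sp eE2.
have uE : (Some u : M) = (Some u : M) * e1 * of_seq V s.
  by rewrite -mulgA -eE1 -[LHS]/(Some u) -[in LHS]ue.
have vE : (Some v : M) = of_seq V p * (e2 * (Some v : M)).
  by rewrite mulgA -eE2 -[LHS]/(Some v) -[in LHS]ev.
have [a au] := approx_exists Vpv LSlV n ((Some u : M) * e1).
have [b bv] := approx_exists Vpv LSlV n (e2 * (Some v : M)).
have aS : approx n s (of_seq V s) := approx_of_seq V _ n s.
have aP : approx n p (of_seq V p) := approx_of_seq V _ n p.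
have := approx_mul (approx_mul au aS) (approx_mul aP bv); rewrite -uE -vE => uv.
move=> /(approx_infix Vpv LSlV uv (leqnn _)); rewrite -catA.
have ts : size t <= size s by rewrite ss.
have tp : size t <= size p by rewrite sp.
case/(infix_mid ts) => [tas|]; last case/(infix_mid tp) => [tsp|tpb].
- by apply: uX; rewrite uE; apply/(approx_infix Vpv LSlV (approx_mul au aS) (leqnn _)).
- have : has_factor t (of_seq V s * of_seq V p).
    exact/(approx_infix Vpv LSlV (approx_mul aS aP) (leqnn _)).
  case=> [c [d cd]]; apply: uX; exists ((Some u : M) * e1 * c), (d * e2).
  have uEE : (Some u : M) = (Some u : M) * ((Some e : M) * (Some e : M)).
    by rewrite mulgA -[LHS]/(Some u) -[in LHS]ue -[in LHS]ue.
  rewrite [in LHS]uEE [X in _ * (X * _)]eE1 eE2 -!mulgA; congr (_ * (_ * _)).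
  by rewrite !mulgA cd.
- by apply: vX; rewrite vE; apply/(approx_infix Vpv LSlV (approx_mul aP bv) (leqnn _)).
Qed.

(** The ends of an arrow with middle [u] are factors of [u], since [u = e * u] and [u = u * f];
    composition is [mirage_mul] and compactness comes from [closed_mirage]. *)
Lemma mirage_compact_subcategory (X : subshift) :
  is_compact_subcategory (mirage_ob V X) (mirage_ar V X).
Proof.
have fac a b (x : freeProV V (alphabet X)) y : mirage V X y ->
    (Some y : withI (freeProV V (alphabet X))) = a * (Some x : withI (freeProV V
      (alphabet X))) * b ->
    mirage V X x.
  by move=> /mirageP yX yE; apply/mirageP; rewrite yE in yX; exact: in_mirage_factor yX.
split.
- move=> a aX; apply: (fac (Some (\val a).1.2) None) aX _.
  by rewrite mulg1; congr Some; rewrite -[LHS]karoubi_arr.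
- move=> a aX; apply: (fac None (Some (\val a).1.2)) aX _.
  by rewrite mul1g; congr Some; rewrite -[LHS]karoubi_arl.
- by [].
- move=> a b ab aX bX; have abE : (\val a).2 = (\val b).1.1 := congr1 \val ab.
  have [_ ff _] := set_valP a.
  apply: (mirage_mul ff) aX bX; first exact: karoubi_arr.
  by rewrite abE; exact: karoubi_arl.
- apply: (subclosed_compact _ (@Ob_compact _) (@subsetT _ _)).
  pose f (c : karoubi_ob (S := freeProV V (alphabet X))) := \val c.
  have cf : continuous f by exact: val_continuous.
  by have := closed_comp (fun c _ => cf c) (@closed_mirage X).
- apply: (subclosed_compact _ (@Ar_compact _) (@subsetT _ _)).
  pose f (a : karoubi_ar (S := freeProV V (alphabet X))) := (\val a).1.2.
  have cf : continuous f.
    pose F := freeProV V (alphabet X).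
    apply: (@continuous_comp_fun (karoubi_ar (S := F)) (F * F * F)%type F \val (fun p
      => p.1.2)).
      exact: val_continuous.
    apply: (@continuous_comp_fun (F * F * F)%type (F * F)%type F fst snd).
      by move=> p; exact: cvg_fst.
    by move=> p; exact: cvg_snd.
  by have := closed_comp (fun c _ => cf c) (@closed_mirage X).
Qed.
End Mirage.

Lemma eq_continuous (T U : topologicalType) (f g : T -> U) :
  f =1 g -> continuous f -> continuous g.
Proof. by move=> /funext ->. Qed.

(** * Block codes of a subshift morphism on mirages *)

Section MirageBlocks.
Variables (V : set finSemigroupType) (Vpv : pseudovariety V).
Variables (LSlV : LSl `<=` V) (VD : V = pv_star V Dpv).
Variables (X Y : subshift) (phi : subshift_hom X Y).
Local Notation F := (freeProV V (alphabet X)).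
Local Notation M := (withI F).

(** A factor [t] of the image appears in the code of a word [v] near [x], so it is the code of a
    factor of [v] of length at most [size t + k.*2]; for [v] close enough this is a factor of [x]
    and occurs in [X]. *)
Lemma in_mirage_block_ext k (Phi : block (alphabet X) (alphabet Y) k) (x : M) :
  central_block_map phi Phi -> in_mirage x -> @in_mirage V Y (block_ext Phi x).
Proof.
move=> cPhi xX t /(has_factorP Vpv LSlV) tx.
have [w wx] := approx_exists Vpv LSlV (size t + k.*2) x.
have ch := @block_ext_continuous V Vpv LSlV VD _ _ _ Phi x.
have n1 := ch _ (open_nbhs_nbhs (conj (wcl_open Vpv (recognized_infix LSlV t)) tx)).
have [_ [[v vw <-]]] := wx _ n1.
rewrite /preimage/= block_ext_seq // => /(wcl_of_seq (recognized_infix LSlV t)) /= tv.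
have [v' [v'v sv' <-]] := infix_block_code tv.
apply: (occurs_block_code cPhi); apply: xX.
apply/(approx_infix Vpv LSlV wx sv').
by case: vw => _ _ <-.
Qed.

(** Adding the context keeps the pseudoword in the mirage: it remains a factor of [e * u * f], which
    is [u]. *)
Lemma context_factor k (e u f : F) : idempotent_elt e -> idempotent_elt f ->
  e * u = u -> u * f = u -> exists a b, Some u =
    a * (of_seq V (suffix_of k e) * (Some u : M) * of_seq V (prefix_of k f)) * b.
Proof.
move=> ee ff eu uf.
have [_ [a aE]] := suffix_ofP Vpv LSlV k ee; have [_ [b bE]] := prefix_ofP Vpv LSlV k ff.
exists a, b; transitivity ((a * of_seq V (suffix_of k e)) * (Some u : M) *
  (of_seq V (prefix_of k f) * b)); last by rewrite !mulgA.
rewrite -aE -bE; by rewrite -[RHS]/(Some (e * u * f)) eu uf.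
Qed.

Lemma PhiK_mid_mirage k (Phi : block (alphabet X) (alphabet Y) k) (e u f : F) :
  central_block_map phi Phi -> idempotent_elt e -> idempotent_elt f ->
  e * u = u -> u * f = u -> mirage V X u ->
  exists2 z, PhiK_mid Phi e u f = Some z & mirage V Y z.
Proof.
move=> cPhi ee ff eu uf /mirageP uX.
have [z zE] := PhiK_mid_Some Vpv LSlV VD Phi f ee eu; exists z => //.
apply/mirageP; rewrite -zE; apply: (in_mirage_block_ext cPhi).
by have [a [b uE]] := context_factor k ee ff eu uf; rewrite uE in uX;
  exact: in_mirage_factor uX.
Qed.

(** On words locally equal to an approximant of [x], flanked by [a] and [b], all factors of window
    length occur in [X], so [block_code_trim] applies; the equality passes to the closure of this
    set of words. *)
Lemma block_ext_trim k d (Phi : block (alphabet X) (alphabet Y) k)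
    (Psi : block (alphabet X) (alphabet Y) (k + d)) (a b : seq (alphabet X)) (x : M) :
  central_block_map phi Phi -> central_block_map phi Psi ->
  size a = d -> size b = d -> in_mirage (of_seq V a * x * of_seq V b) ->
  block_ext Psi (of_seq V a * x * of_seq V b) = block_ext Phi x :> withI (freeProV V
    (alphabet Y)).
Proof.
move=> cPhi cPsi sa sb axb; pose L := (k + d).*2.+1.
have [w wx] := approx_exists Vpv LSlV L x.
have awb := approx_mul (approx_mul (approx_of_seq V _ L a) wx) (approx_of_seq V _ L b).
have cl := @withI_mull_continuous F (of_seq V a);
  have cr := @withI_mulr_continuous F (of_seq V b).
apply: (wcl_min (C := [set x | block_ext Psi (of_seq V a * x * of_seq V b) =
  block_ext Phi x]) _ _ wx) => [|v vw /=].
  apply: closed_eqfun; first exact: withI_hausdorff.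
    apply: (@continuous_comp_fun M M _ (fun x => of_seq V a * x * of_seq V b)
      (block_ext Psi)).
      exact: (@continuous_comp_fun M M M (fun x => of_seq V a * x) (fun x =>
        x * of_seq V b)).
    exact: block_ext_continuous.
  exact: block_ext_continuous.
rewrite -!of_seq_cat !block_ext_seq // (block_code_trim cPhi cPsi) => [|t tv st].
  congr of_seq; congr block_code; rewrite size_cat sb addnK take_size_cat //
    drop_size_cat //.
apply: axb; apply/(approx_infix Vpv LSlV awb st).
have vw' : locally_eq L ((a ++ v) ++ b) ((a ++ w) ++ b).
  by do 2?apply: locally_eq_cat.
by case: vw' => _ _ <-.
Qed.

(** With wings [k] and [k + d], the two contexts of [u] differ by [d] letters on each outer side,
    which is the situation of [block_ext_trim]. *)
Lemma PhiK_mid_indep k l (Phi : block (alphabet X) (alphabet Y) k)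
    (Psi : block (alphabet X) (alphabet Y) l) (e u f : F) :
  central_block_map phi Phi -> central_block_map phi Psi ->
  idempotent_elt e -> idempotent_elt f -> e * u = u -> u * f = u -> mirage V X u ->
  PhiK_mid Psi e u f = PhiK_mid Phi e u f.
Proof.
wlog kl : k l Phi Psi / (k <= l)%N.
  move=> H cPhi cPsi ee ff eu uf uX; have [kl|/ltnW lk] := leqP k l; first exact: H.
  by apply: esym; exact: H.
move=> cPhi cPsi ee ff eu uf /mirageP uX.
have [d ld] : exists d, l = (k + d)%N by exists (l - k)%N; rewrite subnKC.
subst l; clear kl; rewrite /PhiK_mid.
have [se [e1 eE]] := suffix_ofP Vpv LSlV (k + d) ee.
have [sf [f1 fE]] := prefix_ofP Vpv LSlV (k + d) ff.
set t := suffix_of (k + d) e in se eE *; set i := prefix_of (k + d) f in sf fE *.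
have tE : suffix_of k e = drop d t.
  apply: (suffix_ofE Vpv LSlV (v := e1 * of_seq V (take d t))) => //.
    by rewrite size_drop se addnK.
  by rewrite -mulgA -of_seq_cat cat_take_drop.
have iE : prefix_of k f = take k i.
  apply: (prefix_ofE Vpv LSlV (v := of_seq V (drop k i) * f1)) => //.
    by rewrite size_takel // sf leq_addr.
  by rewrite mulgA -of_seq_cat cat_take_drop.
have tui : of_seq V t * (Some u : M) * of_seq V i =
    of_seq V (take d t) * (of_seq V (suffix_of k e) * (Some u : M) * of_seq V
      (prefix_of k f)) *
    of_seq V (drop k i).
  rewrite tE iE -{1}(cat_take_drop d t) -{1}(cat_take_drop k i) !of_seq_cat.
  by rewrite !mulgA.
rewrite tui; apply: (block_ext_trim cPhi cPsi).
- by rewrite size_takel // se leq_addl.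
- by rewrite size_drop sf addKn.
- rewrite -tui; have [a [b uE]] := context_factor (k + d) ee ff eu uf.
  by rewrite uE in uX; exact: in_mirage_factor uX.
Qed.
End MirageBlocks.

(** * The functor between the categories of two mirages *)

Section MirageFunctor.
Variables (V : set finSemigroupType) (Vpv : pseudovariety V).
Variables (LSlV : LSl `<=` V) (VD : V = pv_star V Dpv).
Variable KM : forall X : subshift, is_compact_subcategory (mirage_ob V X) (mirage_ar V X).

Section Objects.
Variable X : subshift.
Implicit Types (c : Ob (mirageK (KM X))) (a : Ar (mirageK (KM X))).

Lemma mirageK_obP c : idempotent_elt (mirageK_ob c) /\ mirage V X (mirageK_ob c).
Proof. by split; [exact: (set_valP (\val c))|exact: (set_valP c)]. Qed.

Lemma mirageK_arP a : let: (e, u, f) := mirageK_ar a in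
  [/\ idempotent_elt e, idempotent_elt f, e * u = u, u * f = u & mirage V X u].
Proof.
have aX : mirage V X (mirageK_ar a).1.2 := set_valP a.
have [ee ff _] := set_valP (\val a).
have eu := karoubi_arl (\val a); have uf := karoubi_arr (\val a).
by move: aX ee ff eu uf; rewrite /mirageK_ar; case: (\val (\val a)) => [[e u] f].
Qed.

Lemma mirageK_ob_exists (e : freeProV V (alphabet X)) : idempotent_elt e ->
  mirage V X e ->
  exists c, mirageK_ob c = e.
Proof.
move=> ee eX.
by exists (Defs.in_set (eX : mirage_ob V X (Defs.in_set (ee : karoubi_ob e)))).
Qed.

Lemma mirageK_ar_exists (e u f : freeProV V (alphabet X)) : idempotent_elt e ->
  idempotent_elt f ->
  u = e * u * f -> mirage V X u -> exists a, mirageK_ar a = (e, u, f).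
Proof.
move=> ee ff euf uX; have aK : karoubi_ar (e, u, f) by split.
by exists (Defs.in_set (uX : mirage_ar V X (Defs.in_set aK))).
Qed.

Lemma mirageK_ob_inj : injective (@mirageK_ob V X (KM X)).
Proof. by move=> c d cd; apply: val_inj; apply: val_inj. Qed.

Lemma mirageK_ar_inj : injective (@mirageK_ar V X (KM X)).
Proof. by move=> c d cd; apply: val_inj; apply: val_inj. Qed.

Lemma mirageK_ob_dom a : mirageK_ob (dom a) = (mirageK_ar a).2.
Proof. by []. Qed.

Lemma mirageK_ob_cod a : mirageK_ob (cod a) = (mirageK_ar a).1.1.
Proof. by []. Qed.

Lemma mirageK_ar_id c :
  mirageK_ar (idc c) = (mirageK_ob c, mirageK_ob c, mirageK_ob c).
Proof. by []. Qed.

Lemma mirageK_ar_comp a b (ab : dom a = cod b) : mirageK_ar (Defs.comp ab) =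
  ((mirageK_ar a).1.1, (mirageK_ar a).1.2 * (mirageK_ar b).1.2, (mirageK_ar b).2).
Proof. by []. Qed.

Lemma mirageK_ob_continuous : continuous (@mirageK_ob V X (KM X)).
Proof.
exact: (continuous_comp_fun (@val_continuous _ _) (@val_continuous _ _)).
Qed.

Lemma mirageK_ar_continuous : continuous (@mirageK_ar V X (KM X)).
Proof.
exact: (continuous_comp_fun (@val_continuous _ _) (@val_continuous _ _)).
Qed.
End Objects.

(** An object [e] is handled through its identity arrow, as [PhiK_ob Phi e] is [PhiK_mid Phi e e e].
    Thus [PhiK_mid_mul] yields both idempotency of the images and functoriality, and
    [PhiK_mid_continuous] yields continuity on objects and on arrows. *)
Lemma restricts_PhiK_exists (X Y : subshift) (phi : subshift_hom X Y) k
    (Phi : block (alphabet X) (alphabet Y) k) : central_block_map phi Phi ->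
  exists G : compactFunctor (mirageK (KM X)) (mirageK (KM Y)), restricts_PhiK Phi G.
Proof.
move=> cPhi.
have obP (e : freeProV V (alphabet X)) : idempotent_elt e -> mirage V X e ->
    exists2 e', PhiK_ob Phi e = Some e' & idempotent_elt e' /\ mirage V Y e'.
  move=> ee eX; have [z zE zY] := PhiK_mid_mirage Vpv LSlV VD cPhi ee ee ee ee eX.
  exists z => //; split=> //.
  have := PhiK_mid_mul Vpv LSlV VD Phi e e ee ee ee; rewrite ee zE.
  by case.
have /choice[fo foP] (c : Ob (mirageK (KM X))) : exists c' : Ob (mirageK (KM Y)),
    Some (mirageK_ob c') = PhiK_ob Phi (mirageK_ob c).
  have [ee eX] := mirageK_obP c; have [z -> [zz zY]] := obP _ ee eX.
  by have [c' <-] := mirageK_ob_exists zz zY; exists c'.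
have /choice[fa faP] (a : Ar (mirageK (KM X))) : exists a' : Ar (mirageK (KM Y)),
    [/\ Some (mirageK_ar a').1.1 = PhiK_ob Phi (mirageK_ar a).1.1,
        Some (mirageK_ar a').1.2 =
          PhiK_mid Phi (mirageK_ar a).1.1 (mirageK_ar a).1.2 (mirageK_ar a).2 &
        Some (mirageK_ar a').2 = PhiK_ob Phi (mirageK_ar a).2].
  have := mirageK_arP a; case: (mirageK_ar a) => [[e u] f] [ee ff eu uf uX] /=.
  have /mirageP uX' := uX.
  have eX : mirage V X e.
    apply/mirageP; apply: (@in_mirage_factor _ _ None _ (Some u)).
    by rewrite mul1g -[_ * _]/(Some (e * u)) eu.
  have fX : mirage V X f.
    apply/mirageP; apply: (@in_mirage_factor _ _ (Some u) _ None).
    by rewrite mulg1 -[_ * _]/(Some (u * f)) uf.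
  have [e' e'E [ee' _]] := obP _ ee eX; have [f' f'E [ff' _]] := obP _ ff fX.
  have [u' u'E u'Y] := PhiK_mid_mirage Vpv LSlV VD cPhi ee ff eu uf uX.
  have eu' : e' * u' = u'.
    have := PhiK_mid_mul Vpv LSlV VD Phi e f ee ee eu.
    by rewrite eu u'E (e'E : PhiK_mid Phi e e e = Some e') => -[].
  have uf' : u' * f' = u'.
    have := PhiK_mid_mul Vpv LSlV VD Phi e f ff uf ff.
    by rewrite uf u'E (f'E : PhiK_mid Phi f f f = Some f') => -[].
  have [|a' a'E] := mirageK_ar_exists ee' ff' _ u'Y; first by rewrite eu' uf'.
  by exists a'; rewrite a'E e'E u'E f'E.
have cob : continuous (@mirageK_ob V X (KM X)) := @mirageK_ob_continuous X.
have car := @mirageK_ar_continuous X.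
pose F := freeProV V (alphabet X).
have c1 : continuous (fun a : Ar (mirageK (KM X)) => (mirageK_ar a).1.1).
  apply: (@continuous_comp_fun _ (F * F * F)%type F (@mirageK_ar V X (KM X)) (fun p =>
    p.1.1)) => //.
  by apply: (@continuous_comp_fun (F * F * F)%type (F * F)%type F fst fst) => p;
    exact: cvg_fst.
have c2 : continuous (fun a : Ar (mirageK (KM X)) => (mirageK_ar a).1.2).
  apply: (@continuous_comp_fun _ (F * F * F)%type F (@mirageK_ar V X (KM X)) (fun p =>
    p.1.2)) => //.
  by apply: (@continuous_comp_fun (F * F * F)%type (F * F)%type F fst snd) => p;
    [exact: cvg_fst|exact: cvg_snd].
have c3 : continuous (fun a : Ar (mirageK (KM X)) => (mirageK_ar a).2).
  apply: (@continuous_comp_fun _ (F * F * F)%type F (@mirageK_ar V X (KM X)) snd) => //.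
  by move=> p; exact: cvg_snd.
have ear (a : Ar (mirageK (KM X))) : idempotent_elt (mirageK_ar a).1.1.
  by have := mirageK_arP a; case: (mirageK_ar a) => [[e u] f] [].
have far' (a : Ar (mirageK (KM X))) : idempotent_elt (mirageK_ar a).2.
  by have := mirageK_arP a; case: (mirageK_ar a) => [[e u] f] [].
have obi (c : Ob (mirageK (KM X))) : idempotent_elt (mirageK_ob c) := (mirageK_obP c).1.
(* Continuity is tested on the underlying pseudowords, after composition with [Some]. *)
have cfo : continuous fo.
  apply: continuous_into; apply: continuous_into; apply: continuous_Some_inv.
  apply: (eq_continuous _ (PhiK_mid_continuous Vpv LSlV VD (Phi :=
    Phi) cob cob cob obi obi)).
  by move=> c; exact: (esym (foP c)).
have cfa : continuous fa.
  apply: continuous_into; apply: continuous_into.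
  have cc1 : continuous (fun a => (mirageK_ar (fa a)).1.1).
    apply: continuous_Some_inv.
    apply: (eq_continuous _ (PhiK_mid_continuous Vpv LSlV VD (Phi :=
      Phi) c1 c1 c1 ear ear)) => a.
    by have [-> _ _] := faP a.
  have cc2 : continuous (fun a => (mirageK_ar (fa a)).1.2).
    apply: continuous_Some_inv.
    apply: (eq_continuous _ (PhiK_mid_continuous Vpv LSlV VD (Phi :=
      Phi) c1 c2 c3 ear far')) => a.
    by have [_ -> _] := faP a.
  have cc3 : continuous (fun a => (mirageK_ar (fa a)).2).
    apply: continuous_Some_inv.
    apply: (eq_continuous _ (PhiK_mid_continuous Vpv LSlV VD (Phi :=
      Phi) c3 c3 c3 far' far')) => a.
    by have [_ _ ->] := faP a.
  apply: (eq_continuous _ (continuous_pair (continuous_pair cc1 cc2) cc3)) => a.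
  by rewrite -/(mirageK_ar (fa a)); case: (mirageK_ar (fa a)) => [[]].
have fdom a : dom (fa a) = fo (dom a).
  apply: mirageK_ob_inj; have [_ _ e3] := faP a; have := foP (dom a).
  by rewrite !mirageK_ob_dom -e3 => -[->].
have fcod a : cod (fa a) = fo (cod a).
  apply: mirageK_ob_inj; have [e1 _ _] := faP a; have := foP (cod a).
  by rewrite !mirageK_ob_cod -e1 => -[->].
have pairE (x : freeProV V (alphabet Y) * freeProV V (alphabet Y) * freeProV V
  (alphabet Y)) e u f :
    Some x.1.1 = Some e -> Some x.1.2 = Some u -> Some x.2 = Some f -> x = (e, u, f).
  by case: x => [[? ?] ?] /= [->] [->] [->].
have fid c : fa (idc c) = idc (fo c).
  apply: mirageK_ar_inj; have := faP (idc c); rewrite !mirageK_ar_id /= => -[e1 e2 e3].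
  by apply: pairE; rewrite ?e1 ?e2 ?e3 foP.
have fcomp g f (gf : dom g = cod f) (gf' : dom (fa g) = cod (fa f)) :
    fa (Defs.comp gf) = Defs.comp gf'.
  apply: mirageK_ar_inj; have := faP (Defs.comp gf);
    rewrite !mirageK_ar_comp /= => -[e1 e2 e3].
  have [g1 g2 _] := faP g; have [_ f2 f3] := faP f.
  have gfE : (mirageK_ar g).2 = (mirageK_ar f).1.1.
    by rewrite -mirageK_ob_dom gf mirageK_ob_cod.
  have gmid : (mirageK_ar g).1.2 * (mirageK_ar g).2 = (mirageK_ar g).1.2.
    by have := mirageK_arP g; case: (mirageK_ar g) => [[? ?] ?] [].
  have fmid : (mirageK_ar g).2 * (mirageK_ar f).1.2 = (mirageK_ar f).1.2.
    by rewrite gfE; have := mirageK_arP f; case: (mirageK_ar f) => [[? ?] ?] [].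
  apply: pairE; [by rewrite e1 g1| |by rewrite e3 f3].
  have := PhiK_mid_mul Vpv LSlV VD Phi (mirageK_ar g).1.1 (mirageK_ar f).2 (far' g)
    gmid fmid.
  by rewrite -g2 {1}gfE -f2 e2 => <-.
exists (CompactFunctor cfo cfa fdom fcod fid fcomp); split=> // a.
have := faP a => /=.
by case: (mirageK_ar a) => [[e u] f]; case: (mirageK_ar (fa a)) => [[e' u'] f'].
Qed.

Lemma restricts_PhiK_indep (X Y : subshift) (phi : subshift_hom X Y) k l
    (Phi : block (alphabet X) (alphabet Y) k) (Psi : block (alphabet X) (alphabet Y) l)
    (G : compactFunctor (mirageK (KM X)) (mirageK (KM Y))) :
  central_block_map phi Phi -> central_block_map phi Psi ->
  restricts_PhiK Phi G -> restricts_PhiK Psi G.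
Proof.
move=> cPhi cPsi [Gob Gar].
have indep (e u f : freeProV V (alphabet X)) : idempotent_elt e -> idempotent_elt f ->
    e * u = u -> u * f = u -> mirage V X u -> PhiK_mid Psi e u f = PhiK_mid Phi e u f.
  exact: (PhiK_mid_indep Vpv LSlV VD cPhi cPsi).
have obE (e : freeProV V (alphabet X)) : idempotent_elt e -> mirage V X e ->
    PhiK_ob Psi e = PhiK_ob Phi e by move=> ee eX; exact: indep.
split=> [c|a]; first by have [cc cX] := mirageK_obP c; rewrite Gob obE.
have [c1 c1X] := mirageK_obP (cod a); have [c2 c2X] := mirageK_obP (dom a).
rewrite mirageK_ob_cod in c1X; rewrite mirageK_ob_dom in c2X.
have := mirageK_arP a; have := Gar a.
move: c1X c2X; case: (mirageK_ar a) => [[e u] f] /= eX fX.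
case: (mirageK_ar (far G a)) => [[e' u'] f'] [-> -> ->] [ee ff eu uf uX].
by rewrite !obE // indep.
Qed.

Lemma restricts_PhiK_arE (X Y : subshift) k (Phi : block (alphabet X) (alphabet Y) k)
    (G : compactFunctor (mirageK (KM X)) (mirageK (KM Y))) a : restricts_PhiK Phi G ->
  [/\ Some (mirageK_ar (far G a)).1.1 = PhiK_ob Phi (mirageK_ar a).1.1,
      Some (mirageK_ar (far G a)).1.2 =
        PhiK_mid Phi (mirageK_ar a).1.1 (mirageK_ar a).1.2 (mirageK_ar a).2 &
      Some (mirageK_ar (far G a)).2 = PhiK_ob Phi (mirageK_ar a).2].
Proof.
by case=> _ /(_ a); case: (mirageK_ar a) => [[? ?] ?]; case: (mirageK_ar _) => [[? ?] ?].
Qed.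

Lemma restricts_PhiK_unique (X Y : subshift) k (Phi : block (alphabet X) (alphabet Y) k)
    (G H : compactFunctor (mirageK (KM X)) (mirageK (KM Y))) :
  restricts_PhiK Phi G -> restricts_PhiK Phi H -> G = H.
Proof.
move=> GP HP; apply: compactFunctor_eq; apply: funext => x.
  by apply: mirageK_ob_inj; have := GP.1 x; rewrite -HP.1 => -[].
apply: mirageK_ar_inj; have [] := restricts_PhiK_arE x GP.
have [<- <- <-] := restricts_PhiK_arE x HP.
by case: (mirageK_ar _) (mirageK_ar _) => [[? ?] ?] [[? ?] ?] /= [->] [->] [->].
Qed.

(** The wing is 0, so the contexts are empty and the code is the identity on words, hence everywhere
    by density. *)
Lemma restricts_PhiK_id (X : subshift) :
  restricts_PhiK (@letter_block (alphabet X)) (cfun_id (mirageK (KM X))).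
Proof.
pose F := freeProV V (alphabet X).
have idE (x : withI F) : block_ext (@letter_block (alphabet X)) x = x.
  apply: (dense_eq Vpv (f := block_ext _) (g := fun x => x)).
  - exact: withI_hausdorff.
  - exact: block_ext_continuous.
  - exact: continuous_id.
  - by move=> w; rewrite block_ext_seq // letter_block_code.
have midE (e u f : F) : idempotent_elt e -> idempotent_elt f ->
    PhiK_mid (@letter_block (alphabet X)) e u f = Some u.
  move=> ee ff; rewrite /PhiK_mid idE.
  rewrite (size0nil (size_suffix_of Vpv LSlV 0 ee)) (size0nil (size_prefix_of Vpv LSlV
    0 ff)).
  by rewrite of_seq_nil mul1g mulg1.
split=> [c|a] /=; first by have [cc _] := mirageK_obP c; rewrite [RHS]midE.
have := mirageK_arP a; case: (mirageK_ar a) => [[e u] f] [ee ff _ _ _].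
by split; rewrite [RHS]midE.
Qed.

Lemma restricts_PhiK_comp (X Y Z : subshift) k l (Psi : block (alphabet Y) (alphabet Z) l)
    (Phi : block (alphabet X) (alphabet Y) k)
    (H : compactFunctor (mirageK (KM Y)) (mirageK (KM Z)))
    (G : compactFunctor (mirageK (KM X)) (mirageK (KM Y))) :
  restricts_PhiK Psi H -> restricts_PhiK Phi G ->
  restricts_PhiK (block_comp Psi Phi) (cfun_comp H G).
Proof.
move=> HP GP.
have obE (e : freeProV V (alphabet X)) e' : idempotent_elt e -> idempotent_elt e' ->
    PhiK_ob Phi e = Some e' -> PhiK_ob (block_comp Psi Phi) e = PhiK_ob Psi e'.
  by move=> ee ee' eE; apply: PhiK_mid_comp.
split=> [c|a] /=.
  have [cc _] := mirageK_obP c; have [cc' _] := mirageK_obP (fob G c).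
  by rewrite HP.1 (obE _ _ cc cc') // GP.1.
have := restricts_PhiK_arE a GP; have := restricts_PhiK_arE (far G a) HP.
have := mirageK_arP a; have := mirageK_arP (far G a).
case: (mirageK_ar a) => [[e u] f]; case: (mirageK_ar (far G a)) => [[e' u'] f'].
case: (mirageK_ar (far H _)) => [[e'' u''] f''] /= [ee' ff' _ _ _] [ee ff eu uf _].
case=> -> -> -> [/esym eE /esym uE /esym fE].
by split; [rewrite (obE e e')|rewrite (PhiK_mid_comp Vpv LSlV VD Psi ee ff ee' ff' eu
  uf eE uE fE)|rewrite (obE f f')].
Qed.
End MirageFunctor.

Theorem theorem5p16 (V : set finSemigroupType) (Vpv : pseudovariety V)
    (LSlV : LSl `<=` V) (VD : V = pv_star V Dpv) :
  exists (KM : forall X : subshift,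
            is_compact_subcategory (mirage_ob V X) (mirage_ar V X))
         (phiK : forall X Y : subshift, subshift_hom X Y ->
            compactFunctor (mirageK (KM X)) (mirageK (KM Y))),
    (forall (X Y : subshift) (phi : subshift_hom X Y) (k : nat)
       (Phi : block (alphabet X) (alphabet Y) k),
       central_block_map phi Phi -> restricts_PhiK Phi (phiK X Y phi)) /\
    @is_functor subshiftCat compactCat (fun X => mirageK (KM X)) phiK.
Proof.
pose KM X := mirage_compact_subcategory Vpv LSlV X.
(* A single functor serves all the block maps of [phi], by [restricts_PhiK_indep]. *)
have phiK_exists X Y (phi : subshift_hom X Y) :
    exists G : compactFunctor (mirageK (KM X)) (mirageK (KM Y)),
    forall k (Phi : block (alphabet X) (alphabet Y) k),
      central_block_map phi Phi -> restricts_PhiK Phi G.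
  have [k [Phi cPhi]] := central_block_map_exists phi.
  have [G GP] := restricts_PhiK_exists Vpv LSlV VD KM cPhi.
  by exists G => l Psi cPsi; exact: (restricts_PhiK_indep Vpv LSlV VD cPhi cPsi GP).
pose phiK X Y phi := sval (cid (phiK_exists X Y phi)).
have phiKP X Y (phi : subshift_hom X Y) k (Phi : block (alphabet X) (alphabet Y) k) :
    central_block_map phi Phi -> restricts_PhiK Phi (phiK X Y phi).
  by rewrite /phiK; case: cid => G GP; exact: GP.
exists KM, phiK; split; first exact: phiKP.
split=> [X|X Y Z psi phi].
  (* A functor is determined by any block map that it restricts, so each functor law reduces to a
     common block map for its two sides: the letter block for identities, [block_comp] for
     composites. *)
  apply: restricts_PhiK_unique (restricts_PhiK_id Vpv LSlV VD KM X).
  exact/phiKP/central_letter_block.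
have [k [Phi cPhi]] := central_block_map_exists phi.
have [l [Psi cPsi]] := central_block_map_exists psi.
apply: restricts_PhiK_unique (restricts_PhiK_comp Vpv LSlV VD (phiKP _ _ _ _ _ cPsi)
  (phiKP _ _ _ _ _ cPhi)).
exact/phiKP/central_block_comp.
Qed.
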